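(* Let $0<q<1$, let $\Xi=\{\xi_j\}_{j\ge 0}$ be positive reals uniformly bounded away from $0$ and $+\infty$, and $S=\{s_j\}_{j\ge0}\subset(-1,0)$ uniformly bounded away from $-1$ and $0$, with $$\inf_{j}\frac{|s_j|}{\xi_j}>q\,\sup_{j}\frac{|s_j|}{\xi_j},\qquad \inf_{j}\frac{1}{\xi_j|s_j|}>\sup_{j}\frac{|s_j|}{\xi_j}.$$ Then for any $k\ge1$ and $\lambda,\mu\in\mathrm{Sign}_k^+$, $$(1-q)^{-k}\oint_{\gamma_1^+}\frac{du_1}{2\pi\mathbf i}\cdots\oint_{\gamma_k^+}\frac{du_k}{2\pi\mathbf i}\prod_{1\le\alpha<\beta\le k}\frac{u_\alpha-u_\beta}{u_\alpha-qu_\beta}\;F^c_\lambda(u_1,\dots,u_k\,|\,\Xi,S)\prod_{i=1}^ku_i^{-1}\varphi_{\mu_i}(u_i^{-1}\,|\,\bar\Xi,S)=\mathbf 1_{\lambda=\mu}.$$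
   Context: $\mathrm{Sign}_k^+$ is the set of integer sequences $\lambda_1\ge\dots\ge\lambda_k\ge0$. $(z;q)_m=\prod_{i=0}^{m-1}(1-zq^i)$, $\bar\Xi=\{\xi_j^{-1}\}_{j\ge0}$. For $m\ge0$, $\varphi_m(u\,|\,\Xi,S)=\frac{1-q}{1-s_m\xi_mu}\prod_{j=0}^{m-1}\frac{\xi_ju-s_j}{1-s_j\xi_ju}$, and $$F_\lambda(u_1,\dots,u_k\,|\,\Xi,S)=\sum_{\sigma\in\mathfrak S_k}\sigma\Big(\prod_{1\le\alpha<\beta\le k}\frac{u_\alpha-qu_\beta}{u_\alpha-u_\beta}\prod_{i=1}^k\varphi_{\lambda_i}(u_i\,|\,\Xi,S)\Big),$$ with $\sigma$ permuting the $u_i$. $F^c_\lambda=c_S(\lambda)F_\lambda$, $c_S(\lambda)=\prod_{j\ge0}\frac{(s_j^2;q)_{m_j}}{(q;q)_{m_j}}$, where $m_j$ is the multiplicity of $j$ in $\lambda$. Contours: $\gamma_1^+,\dots,\gamma_k^+$ are positively oriented closed contours such that each $\gamma_\alpha^+$ encircles all points $\xi_i^{-1}s_i$, $i\ge0$, and leaves outside all points $\xi_i^{-1}s_i^{-1}$, $i\ge0$; for $\beta>\alpha$ the interior of $\gamma_\alpha^+$ contains $q\gamma_\beta^+$ (image of $\gamma_\beta^+$ under multiplication by $q$); and $\gamma_k^+$ is small enough not to intersect $q\gamma_k^+$. *)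

(* Defs.v *)
From HB Require Import structures.
From mathcomp Require Import all_boot all_order all_algebra all_fingroup.
From mathcomp Require Import complex.
From mathcomp Require Import all_classical all_reals all_analysis.

Set Implicit Arguments.
Unset Strict Implicit.
Unset Printing Implicit Defensive.

Import Order.TTheory GRing.Theory Num.Theory.
Import numFieldNormedType.Exports.

Local Open Scope classical_set_scope.
Local Open Scope ring_scope.
Local Open Scope complex_scope.

Section RationalFunctions.
Variables (K : fieldType) (q : K).

Definition qpoch (z : K) (m : nat) : K := \prod_(i < m) (1 - z * q ^+ i).

Variables (xi s : nat -> K).

Definition phi (m : nat) (u : K) : K :=
  (1 - q) / (1 - s m * xi m * u) *
  \prod_(j < m) ((xi j * u - s j) / (1 - s j * xi j * u)).

Definition Ffun (k : nat) (lam : k.-tuple nat) (u : 'I_k -> K) : K :=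
  \sum_(sigma : 'S_k)
    ((\prod_(a < k) \prod_(b < k | (a < b)%N)
        ((u (sigma a) - q * u (sigma b)) / (u (sigma a) - u (sigma b)))) *
     \prod_(i < k) phi (tnth lam i) (u (sigma i))).

(* The factors of the product over all j >= 0 with m_j = 0 are equal to 1, so
   it is enough to range over the distinct parts of lam. *)
Definition cS (k : nat) (lam : k.-tuple nat) : K :=
  \prod_(j <- undup lam)
    (qpoch (s j ^+ 2) (count_mem j lam) / qpoch q (count_mem j lam)).

Definition Fc (k : nat) (lam : k.-tuple nat) (u : 'I_k -> K) : K :=
  cS lam * Ffun lam u.

End RationalFunctions.

Definition is_sign (k : nat) (lam : k.-tuple nat) : Prop := sorted geq lam.

Section Contours.
Variable R : realType.
Implicit Types (g : R -> R[i]) (f : R[i] -> R[i]) (z : R[i]) (h : R -> R).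

Definition C1_up_to_ends (a b : R) h : Prop :=
  [/\ forall t, a < t < b -> derivable h t 1,
      forall t, a < t < b -> {for t, continuous (derive1 h)},
      cvg (derive1 h t @[t --> a^'+]) &
      cvg (derive1 h t @[t --> b^'-])].

(* The breakpoints are 0 :: p, with last element 1. *)
Definition piecewise_C1 h : Prop :=
  {within `[0, 1], continuous h} /\
  exists p : seq R,
    [/\ path <%R 0 p, last 0 p = 1 &
        forall i, (i < size p)%N ->
          C1_up_to_ends (nth 0 (0 :: p) i) (nth 0 (0 :: p) i.+1) h].

(* Curves are parametrized by [0, 1]; values outside [0, 1] are irrelevant. *)
Definition simple_closed_curve g : Prop :=
  [/\ piecewise_C1 (fun t => complex.Re (g t)),
      piecewise_C1 (fun t => complex.Im (g t)),
      g 0 = g 1 &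
      {in `[0, 1[ &, injective g}].

Definition trace g : set R[i] := g @` `[0, 1].

Definition velocity g (t : R) : R[i] :=
  derive1 (fun x => complex.Re (g x)) t +i* derive1 (fun x => complex.Im (g x)) t.

(* velocity g is only meaningful off the (finitely many) breakpoints, which
   do not contribute to the Lebesgue integral. *)
Definition contour_integral g f : R[i] :=
  (\int[lebesgue_measure]_(t in `[0, 1])
      complex.Re (f (g t) * velocity g t))%R +i*
  (\int[lebesgue_measure]_(t in `[0, 1])
      complex.Im (f (g t) * velocity g t))%R.

Definition oint g f : R[i] := (2 * (@pi R)%:C * 'i%C)^-1 * contour_integral g f.

Definition winding_number g z : R[i] := oint g (fun u => (u - z)^-1).

(* Union of the bounded connected components of the complement of the trace;
   the complex plane is identified with R * R for its topology. *)
Definition curve_interior g : set R[i] := [set z | ~ trace g z /\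
  bounded_set (connected_component [set p : R * R | ~ trace g (p.1 +i* p.2)]
                 (complex.Re z, complex.Im z))].

Definition curve_exterior g : set R[i] :=
  [set z | ~ trace g z /\ ~ curve_interior g z].

Definition positively_oriented g : Prop :=
  forall z, curve_interior g z -> winding_number g z = 1.

Definition contour g : Prop := simple_closed_curve g /\ positively_oriented g.

Definition ucons (T : Type) (k : nat) (x : T) (v : 'I_k -> T) : 'I_k.+1 -> T :=
  fun i => if unlift ord0 i is Some j then v j else x.

(* The integral over gam ord0 is the outermost one. *)
Fixpoint iter_oint (k : nat) :
    ('I_k -> R -> R[i]) -> (('I_k -> R[i]) -> R[i]) -> R[i] :=
  match k with
  | 0 => fun _ F => F (fun _ => 0)
  | n.+1 => fun gam F =>
      oint (gam ord0) (fun x =>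
        iter_oint (fun i : 'I_n => gam (lift ord0 i))
                  (fun v => F (ucons x v)))
  end.

(* gam i stands for the (i+1)-st contour. *)
Definition admissible_contours (q : R) (xi s : nat -> R) (k : nat)
    (gam : 'I_k -> R -> R[i]) : Prop :=
  [/\ forall a, contour (gam a),
      forall a i, curve_interior (gam a) ((xi i)^-1 * s i)%:C,
      forall a i, curve_exterior (gam a) ((xi i)^-1 * (s i)^-1)%:C,
      forall a b : 'I_k, (a < b)%N ->
        [set q%:C * z | z in trace (gam b)] `<=` curve_interior (gam a) &
      forall a : 'I_k, a.+1 = k ->
        trace (gam a) `&` [set q%:C * z | z in trace (gam a)] = set0].

End Contours.

(* Main.v *)
(** Expanding [F_lambda] over permutations, the prefactor turns the summand of
    [sigma] into a product of one-variable functions [phi_{lambda_(t i)} psi_{mu_i}]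
    (with [t] the inverse of [sigma]) and of factors
    [(q u_a - u_b) / (u_a - q u_b)] over the inversions [a < b] of [t].

    Integrating the innermost variable first, its poles are either those of its
    own factor or the points [u_a / q], which lie outside its contour.  Every
    residue is again a combination of products of one-variable functions of the
    outer variables: proper rational functions with poles in [q] times the
    interior, hence inside the outer contours.  So no exchange of integrals is
    needed, and the integral vanishes as soon as some variable has no pole inside
    and is coupled only to outer variables, or has no pole outside, decays like
    [u^-2] and is coupled only to inner ones.  Applied at the left-to-right maxima
    and right-to-left minima of [t] this leaves only [lambda o t = mu], whence
    [lambda = mu] and [t] stabilizes [lambda].  The sum over the stabilizer is a
    Hall-Littlewood type constant, and the remaining integral telescopes: each
    residue moves the pole [p] of the variables of the same block to [q p].

    No Jordan curve theorem is used: the winding number is locally constant, hence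
    zero on unbounded components, and nesting of the contours follows from
    connectedness. *)
Require Import Defs.
From HB Require Import structures.
From mathcomp Require Import all_boot all_order all_algebra all_fingroup.
From mathcomp Require Import complex ring lra zify.
From mathcomp Require Import all_classical all_reals all_analysis.
From mathcomp Require Import measurable_realfun.

Set Implicit Arguments.
Unset Strict Implicit.
Unset Printing Implicit Defensive.

Import Order.TTheory GRing.Theory Num.Theory.
Import numFieldNormedType.Exports.

Local Open Scope classical_set_scope.
Local Open Scope ring_scope.
Local Open Scope complex_scope.

(** The contours may cross one another, so on the traces the summands of [Ffun] meet the diagonals
    [u_a = u_b], where division by zero returns 0 and the cancellation against the prefactor breaks
    down; the same happens at [u_i = 0]. Identities between integrands are therefore used only at
    generic points. At each level this discards finitely many values, which a curve injective on [0,
    1[ takes at finitely many parameters, so the integrals do not see them. Powers of [u - p] other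
    than -1 have primitives, so rational integrals only involve winding numbers. For the vanishing
    terms no residue is evaluated: it is enough to know to which class of functions the inner
    integral belongs. Exact residues are taken only in the diagonal term, at simple poles. The
    permutations stabilizing [lam] are not integrated one by one. Their sum is collapsed pointwise
    to a constant, which leaves one in-block factor [(u_a - u_b) / (u_a - q u_b)] per pair; it is
    this shape of factor that makes the residues telescope. *)

(** * Integrals over [0, 1] that ignore finite sets; fundamental theorem of calculus with
    breakpoints *)

Section RealIntegrals.
Variable R : realType.
Implicit Types (h Phi Psi : R -> R) (D : seq R).
Local Notation mu := (@lebesgue_measure R).

Lemma set_seq_cons (T : eqType) (x : T) (s : seq T) :
  [set` x :: s] = [set x] `|` [set` s].
Proof.
apply/seteqP; split=> y /=; rewrite inE; first by case/orP => [/eqP|]; [left|right].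
by case=> [->|->]; rewrite ?eqxx ?orbT.
Qed.

Lemma measurable_seq D : measurable ([set` D] : set R).
Proof.
elim: D => [|d D IH]; first by rewrite classical_sets.set_nil.
rewrite set_seq_cons; apply: measurableU => //; exact: measurable_set1.
Qed.

Lemma measurable_fun_off_seq (A : set R) D h :
  measurable A -> measurable_fun (A `\` [set` D]) h -> measurable_fun A h.
Proof.
move=> mA mh.
have mD := measurable_seq D.
have -> : A = (A `\` [set` D]) `|` (A `&` [set` D]).
  by rewrite setUC setUIDK.
have mAD : measurable (A `\` [set` D]) by exact: measurableD.
have mAI : measurable (A `&` [set` D]) by exact: measurableI.
apply/(measurable_funU _ mAD mAI); split => //.
apply: (@measurable_funS _ _ _ _ [set` D]); [exact: mD|by move=> t []|].
elim: D {mh mD mAD mAI} => [|d D IH].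
  by rewrite classical_sets.set_nil; exact: measurable_fun_set0.
rewrite set_seq_cons; apply/measurable_funU.
- exact: measurable_set1.
- exact: measurable_seq.
- split => //; exact: measurable_fun_set1.
Qed.

(** Bounded and measurable rather than integrable, because this class is closed under products. *)
Definition bdd_meas h :=
  measurable_fun (`[0, 1] : set R) h /\ exists M : R, forall t : R, 0 <= t <= 1 -> `|h t| <= M.

Lemma bdd_meas_integrable h : bdd_meas h -> mu.-integrable `[0, 1] (EFin \o h).
Proof.
move=> [mh [M hM]]; apply: measurable_bounded_integrable => //.
  by rewrite /= lebesgue_measure_itv /= lte_fin ltr01 sube0 ltry.
exists M; split; first exact: num_real.
by move=> N MN t; rewrite /= in_itv /= => t01; apply: le_trans (ltW MN); exact: hM.
Qed.

Lemma bdd_meas_eq_off D h h' : (forall t : R, 0 <= t <= 1 -> t \notin D -> h t = h' t) ->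
  bdd_meas h -> bdd_meas h'.
Proof.
move=> hh' [mh [M hM]]; split.
  apply: (@measurable_fun_off_seq _ D) => //.
  apply: (eq_measurable_fun h).
    move=> t; rewrite inE /= => -[]; rewrite in_itv /= => t01 /negP tD.
    exact: hh'.
  by apply: measurable_funS mh => //; exact: subDsetl.
elim: D h' hh' => [|d D IH] h' hh'.
  by exists M => t t01; rewrite -hh' //; exact: hM.
(* Overwriting [h'] by [h] at [d] removes one exceptional point. *)
have [|M' hM'] := IH (fun t => if t == d then h t else h' t).
  move=> t t01 tD; case: eqP => // /eqP td.
  by apply: hh' => //; rewrite inE negb_or td.
exists (`|M'| + `|h' d|) => t t01.
have := hM' _ t01; case: eqP => [->|_] h1.
  by rewrite lerDr.
by apply: (le_trans h1); apply: (le_trans (ler_norm _)); rewrite lerDl.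
Qed.

Lemma Rintegral_eq_off D h h' : (forall t : R, 0 <= t <= 1 -> t \notin D -> h t = h' t) ->
  bdd_meas h ->
  (\int[mu]_(t in `[0, 1]) h t = \int[mu]_(t in `[0, 1]) h' t)%R.
Proof.
move=> hh' bh; have bh' := bdd_meas_eq_off hh' bh.
have mI : measurable (`[0, 1]%classic : set R) by [].
have key g : bdd_meas g ->
    (\int[mu]_(t in `[0%R, 1%R]) (g t)%:E = \int[mu]_(t in `[0%R, 1%R] `\` [set` D]) (g t)%:E)%E.
  move=> [mg _]; elim: D {hh'} => [|d D IH]; first by rewrite classical_sets.set_nil setD0.
  rewrite IH set_seq_cons setUC -setDDl integral_setD1 //.
    apply: measurableD; last exact: measurable_set1.
    by apply: measurableD => //; exact: measurable_seq.
  apply/measurable_EFinP; apply: measurable_funS mg => //.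
  by move=> t [[]].
rewrite /Rintegral !key //; congr fine; apply: eq_integral => t.
rewrite inE /= => -[]; rewrite in_itv /= => t01 /negP tD.
by rewrite hh'.
Qed.

Lemma bdd_measD h h' : bdd_meas h -> bdd_meas h' -> bdd_meas (fun t => h t + h' t).
Proof.
move=> [mh [M hM]] [mh' [M' hM']]; split; first exact: measurable_funD.
exists (M + M') => t t01; apply: (le_trans (ler_normD _ _)).
by apply: lerD; [exact: hM|exact: hM'].
Qed.

Lemma bdd_measM h h' : bdd_meas h -> bdd_meas h' -> bdd_meas (fun t => h t * h' t).
Proof.
move=> [mh [M hM]] [mh' [M' hM']]; split; first exact: measurable_funM.
exists (M * M') => t t01; rewrite normrM.
by apply: ler_pM => //; [exact: hM|exact: hM'].
Qed.

Lemma bdd_meas_cst (c : R) : bdd_meas (fun=> c).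
Proof. by split; [exact: measurable_cst|exists `|c|]. Qed.

Lemma bdd_measN h : bdd_meas h -> bdd_meas (fun t => - h t).
Proof.
move=> bh; have := bdd_measM (bdd_meas_cst (-1)) bh.
by under eq_fun do rewrite mulN1r.
Qed.

Lemma bdd_meas_continuous h : {within `[0, 1], continuous h} -> bdd_meas h.
Proof.
move=> ch; split; first exact: subspace_continuous_measurable_fun.
have [c1 _ h1] := EVT_max ler01 ch; have [c2 _ h2] := EVT_min ler01 ch.
exists (`|h c1| + `|h c2|) => t t01.
have := h1 t; have := h2 t; rewrite !in_itv /= t01 => /(_ isT) l2 /(_ isT) l1.
have := ler_norm (h c1); have := ler_norm (- h c2); rewrite normrN.
have := normr_ge0 (h c1); have := normr_ge0 (h c2).
by rewrite ler_norml => *; apply/andP; split; lra.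
Qed.

Lemma Rintegral_le_bound h (M : R) : bdd_meas h -> (forall t : R, 0 <= t <= 1 -> `|h t| <= M) ->
  `|(\int[mu]_(t in `[0, 1]) h t)%R| <= M.
Proof.
move=> bh hM; have ih := bdd_meas_integrable bh.
have bM := bdd_meas_cst M; have iM := bdd_meas_integrable bM.
have h1 := le_normr_Rintegral _ ih; apply: (le_trans (h1 _)) => //.
have -> : M = (\int[mu]_(t in `[0, 1]) M)%R.
  by rewrite Rintegral_cst //= lebesgue_measure_itv /= lte_fin ltr01 sube0 mulr1.
apply: le_Rintegral => //; exact: integrable_norm.
Qed.

(** The exceptional list is unordered and may be enlarged freely, so sums and products just
    concatenate lists instead of merging subdivisions. *)
Definition pw_smooth Phi := {within `[0, 1], continuous Phi} /\
  exists (D : seq R) (M : R), forall t : R, 0 < t < 1 -> t \notin D ->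
    [/\ derivable Phi t 1, {for t, continuous (derive1 Phi)} & `|derive1 Phi t| <= M].

Lemma bdd_meas_derive1 Phi : pw_smooth Phi -> bdd_meas (derive1 Phi).
Proof.
move=> [cPhi [D [M hD]]].
pose D' := [:: 0, 1 & D].
(* At exceptional points [derive1] has an uncontrolled value; zeroing it there gives a bound on the
   whole interval. *)
pose h' t := if t \in D' then 0 else derive1 Phi t.
have hh' t : 0 <= t <= 1 -> t \notin D' -> h' t = derive1 Phi t.
  by move=> _ /negPf; rewrite /h' => ->.
have inD' t : 0 <= t <= 1 -> t \notin D' -> 0 < t < 1 /\ t \notin D.
  move=> /andP[t0 t1]; rewrite !inE !negb_or => /and3P[tn0 tn1 ->].
  by rewrite !lt_neqAle t0 t1 eq_sym tn0 tn1.
apply: (bdd_meas_eq_off hh'); split; last first.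
  exists `|M| => t t01; rewrite /h'; case: ifPn => [_|tD']; first by rewrite normr0.
  have [t01' tD] := inD' _ t01 tD'.
  by have [_ _ /le_trans] := hD _ t01' tD; apply; exact: ler_norm.
apply: (@measurable_fun_off_seq _ D') => //.
have oA : open (`]0, 1[ `\` [set` D] : set R).
  rewrite setDE; apply: openI; [exact: interval_open|apply: closed_openC].
  elim: (D) => [|d E IH]; first by rewrite classical_sets.set_nil; exact: closed0.
  by rewrite set_seq_cons; apply: closedU => //; exact: closed_eq.
apply: (@measurable_funS _ _ _ _ (`]0, 1[ `\` [set` D])).
- exact: open_measurable.
- move=> t [] /=; rewrite in_itv /= => t01 /negP tD'.
  by have [t01' /negP tD] := inD' _ t01 tD'; rewrite in_itv.
apply: (eq_measurable_fun (derive1 Phi)).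
  move=> t; rewrite inE => -[] /=; rewrite in_itv /= => /andP[t0 t1] /negP tD.
  by rewrite /h' !inE (gt_eqF t0) (lt_eqF t1) (negPf tD).
apply: open_continuous_measurable_fun => // t.
rewrite inE => -[] /=; rewrite in_itv /= => t01 /negP tD.
by have [] := hD _ t01 tD.
Qed.

(** Each exceptional point inside the interval cuts it in two, and continuity glues the halves; once
    none is left the mean value theorem applies. *)
Lemma eq_of_derive_eq0_off D h (a b : R) : a <= b -> {within `[a, b], continuous h} ->
  (forall t : R, a < t < b -> t \notin D -> is_derive t 1 h 0) -> h a = h b.
Proof.
elim: D a b => [|d D IH] a b ab ch dh.
  have dh' : forall t, t \in `]a, b[%R -> is_derive t 1 h ((fun=> 0) t).
    by move=> t; rewrite in_itv /= => tab; exact: dh.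
  have [c _] := MVT_segment ab dh' ch.
  by rewrite mul0r => /eqP; rewrite subr_eq0 => /eqP.
have [dab|dab] := boolP (a < d < b); last first.
  apply: IH => // t tab tD; apply: dh => //; rewrite inE negb_or tD andbT.
  by apply: contraNneq dab => <-.
have /andP[ad db] := dab.
have had : h a = h d.
  apply: IH; [exact: ltW| |].
    by apply: continuous_subspaceW ch => t /=; rewrite !in_itv /= => /andP[]; lra.
  move=> t /andP[td tb] tD; apply: dh; first lra.
  by rewrite inE negb_or tD andbT lt_eqF.
rewrite had; apply: IH; [exact: ltW| |].
  by apply: continuous_subspaceW ch => t /=; rewrite !in_itv /= => /andP[]; lra.
move=> t /andP[td tb] tD; apply: dh; first lra.
by rewrite inE negb_or tD andbT gt_eqF.
Qed.

(** The indefinite integral of the derivative is continuous and has the derivative of [Phi] wherever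
    that one is continuous, so its difference with [Phi] has zero derivative off a finite set. *)
Lemma Rintegral_derive1 Phi : pw_smooth Phi ->
  (\int[mu]_(t in `[0, 1]) (derive1 Phi t))%R = Phi 1 - Phi 0.
Proof.
move=> sPhi; have iPhi := bdd_meas_integrable (bdd_meas_derive1 sPhi).
case: sPhi => cPhi [D [M hD]].
pose G x := (\int[mu]_(t in `[0, x]) (derive1 Phi t))%R.
have cG : {within `[0, 1], continuous G}.
  exact: parameterized_integral_continuous.
have G0 : G 0 = 0 by rewrite /G set_itv1 Rintegral_set1.
have : (fun t => G t - Phi t) 0 = (fun t => G t - Phi t) 1.
  apply: (@eq_of_derive_eq0_off D (fun t => G t - Phi t) 0 1) => //.
    by move=> t; apply: cvgB; [exact: cG|exact: cPhi].
  move=> t t01 tD; have [dP cP _] := hD _ t01 tD.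
  have /andP[t0 t1] := t01.
  have [dG GE] := continuous_FTC1_closed t1 iPhi t0 cP.
  rewrite -(subrr (derive1 Phi t)) -{1}GE !derive1E.
  exact: (is_deriveB (DeriveDef dG erefl) (DeriveDef dP erefl)).
by rewrite /= G0 sub0r => /eqP; rewrite eq_sym subr_eq addrC => /eqP.
Qed.
End RealIntegrals.

(** * Closure properties of piecewise smooth real functions *)

Section SmoothFunctions.
Variable R : realType.
Implicit Types (h Phi Psi : R -> R) (D : seq R).

Lemma near_off_seq D (a b t : R) : a < t < b -> t \notin D ->
  \forall u \near t, a < u < b /\ u \notin D.
Proof.
move=> tab tD.
have oA : open (`]a, b[ `\` [set` D] : set R).
  rewrite setDE; apply: openI; [exact: interval_open|apply: closed_openC].
  elim: (D) => [|d E IH]; first by rewrite classical_sets.set_nil; exact: closed0.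
  by rewrite set_seq_cons; apply: closedU => //; exact: closed_eq.
have At : (`]a, b[ `\` [set` D] : set R) t by split; [rewrite /= in_itv|exact/negP].
have := open_nbhs_nbhs (conj oA At); apply: filterS => u [] /=.
by rewrite in_itv /= => uab /negP.
Qed.

Lemma pw_smooth_intro Phi (dPhi : R -> R) D (M : R) :
  {within `[0, 1], continuous Phi} ->
  (forall t : R, 0 < t < 1 -> t \notin D ->
    [/\ is_derive t 1 Phi (dPhi t), {for t, continuous dPhi} & `|dPhi t| <= M]) ->
  pw_smooth Phi.
Proof.
move=> cPhi hD; split => //; exists D, M => t t01 tD.
have E (u : R) : 0 < u < 1 -> u \notin D -> derive1 Phi u = dPhi u.
  by move=> u01 uD; have [du _ _] := hD _ u01 uD; rewrite derive1E derive_val.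
have [dt ct bt] := hD _ t01 tD; split; [exact: ex_derive| |by rewrite E].
move: ct; rewrite /prop_for /continuous_at E // => ct; apply: cvg_trans ct; apply: near_eq_cvg.
have := near_off_seq t01 tD; apply: filterS => u [u01 uD].
by rewrite E.
Qed.

Lemma pw_smoothE Phi : pw_smooth Phi -> exists D (M : R), forall t : R, 0 < t < 1 ->
  t \notin D -> [/\ is_derive t 1 Phi (derive1 Phi t),
    {for t, continuous (derive1 Phi)}, {for t, continuous Phi} & `|derive1 Phi t| <= M].
Proof.
move=> [_ [D [M hD]]]; exists D, M => t t01 tD.
have [dt ct bt] := hD t t01 tD.
have d1 : is_derive t 1 Phi (derive1 Phi t).
  by rewrite derive1E; exact: (DeriveDef dt erefl).
have c1 : {for t, continuous Phi}.
  exact: (differentiable_continuous (iffLR (@derivable1_diffP R R Phi t) dt)).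
by split; [exact: d1|exact: ct|exact: c1|exact: bt].
Qed.

Lemma within_bound h : {within `[0, 1], continuous h} ->
  exists M : R, 0 <= M /\ forall t : R, 0 < t < 1 -> `|h t| <= M.
Proof.
move=> /bdd_meas_continuous[_ [M hM]]; exists `|M|; split => // t /andP[t0 t1].
by apply: (le_trans (hM _ _) (ler_norm _)); rewrite !ltW.
Qed.

Lemma pw_smooth_cst (c : R) : pw_smooth (fun=> c).
Proof.
apply: (@pw_smooth_intro _ (fun=> 0) [::] 0); first by move=> t; exact: cvg_cst.
move=> t _ _; split; [exact: is_derive_cst|exact: cvg_cst|by rewrite normr0].
Qed.

Lemma pw_smoothD Phi Psi : pw_smooth Phi -> pw_smooth Psi ->
  pw_smooth (fun t => Phi t + Psi t).
Proof.
move=> sP sQ; have [D [M hD]] := pw_smoothE sP; have [E [N hE]] := pw_smoothE sQ.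
apply: (@pw_smooth_intro _ (fun t => derive1 Phi t + derive1 Psi t) (D ++ E) (M + N)).
  by move=> t; apply: cvgD; [exact: sP.1|exact: sQ.1].
move=> t t01; rewrite mem_cat negb_or => /andP[tD tE].
have [d1 c1 _ b1] := hD _ t01 tD; have [d2 c2 _ b2] := hE _ t01 tE.
split; [exact: is_deriveD|exact: cvgD|].
by apply: (le_trans (ler_normD _ _)); exact: lerD.
Qed.

Lemma pw_smoothM Phi Psi : pw_smooth Phi -> pw_smooth Psi ->
  pw_smooth (fun t => Phi t * Psi t).
Proof.
move=> sP sQ; have [D [M hD]] := pw_smoothE sP; have [E [N hE]] := pw_smoothE sQ.
have [B [B0 hB]] := within_bound sP.1; have [C [C0 hC]] := within_bound sQ.1.
apply: (@pw_smooth_intro _ (fun t => Phi t * derive1 Psi t + Psi t * derive1 Phi t)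
  (D ++ E) (B * N + C * M)).
  by move=> t; apply: cvgM; [exact: sP.1|exact: sQ.1].
move=> t t01; rewrite mem_cat negb_or => /andP[tD tE].
have [d1 c1 c1' b1] := hD _ t01 tD; have [d2 c2 c2' b2] := hE _ t01 tE.
split; [exact: is_deriveM|by apply: cvgD; exact: cvgM|].
apply: (le_trans (ler_normD _ _)); rewrite !normrM.
by apply: lerD; apply: ler_pM => //; [exact: hB|exact: hC].
Qed.

Lemma pw_smoothN Phi : pw_smooth Phi -> pw_smooth (fun t => - Phi t).
Proof.
move=> sP; have := pw_smoothM (pw_smooth_cst (-1)) sP.
by under eq_fun do rewrite mulN1r.
Qed.

Lemma within_continuousV Phi : {within `[0, 1], continuous Phi} ->
  (forall t : R, 0 <= t <= 1 -> Phi t != 0) ->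
  {within `[0, 1], continuous (fun t => (Phi t)^-1)}.
Proof.
move=> cP nz; apply/continuous_within_itvP => //.
move/continuous_within_itvP : cP => /(_ ltr01)[c0 cl cr]; split.
- move=> t t01; apply: cvgV; last exact: c0.
  by apply: nz; move: t01; rewrite in_itv /= => /andP[? ?]; rewrite !ltW.
- by apply: cvgV => //; apply: nz; rewrite lexx ler01.
- by apply: cvgV => //; apply: nz; rewrite lexx ler01.
Qed.

Lemma pw_smoothV Phi : pw_smooth Phi -> (forall t : R, 0 <= t <= 1 -> Phi t != 0) ->
  pw_smooth (fun t => (Phi t)^-1).
Proof.
move=> sP nz; have [D [M hD]] := pw_smoothE sP.
have cV := within_continuousV sP.1 nz.
have [B [B0 hB]] := within_bound cV.
apply: (@pw_smooth_intro _ (fun t => - (Phi t) ^- 2 * derive1 Phi t) D (B ^+ 2 * M)) => //.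
move=> t t01 tD; have [d1 c1 c1' b1] := hD _ t01 tD.
have nzt : Phi t != 0 by apply: nz; case/andP: t01 => *; rewrite !ltW.
split; first exact: is_deriveV.
  apply: cvgM => //; apply: cvgN; apply: cvgV; first exact: expf_neq0.
  by under eq_fun do rewrite expr2; rewrite expr2; exact: cvgM.
rewrite normrM normrN -exprVn normrX; apply: ler_pM => //.
by rewrite lerXn2r ?nnegrE //; exact: hB.
Qed.

(** The one-sided limits extend the derivative to a continuous function on the closed interval,
    where the extreme value theorem bounds it. *)
Lemma C1_bounded (a b : R) h : a < b -> C1_up_to_ends a b h ->
  exists M : R, forall t, a < t < b -> `|derive1 h t| <= M.
Proof.
move=> ab [_ ch /cvg_ex[/= l hl] /cvg_ex[/= r hr]].
pose f t := if t <= a then l else if b <= t then r else derive1 h t.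
have fE t : a < t < b -> f t = derive1 h t.
  by rewrite /f => /andP[? ?]; rewrite !leNgt; case: ifPn => [/negP//|_]; case: ifPn => [/negP//|].
have cf : {within `[a, b], continuous f}.
  apply/continuous_within_itvP => //; split.
  - move=> t; rewrite in_itv /= => tab; rewrite /continuous_at fE //.
    apply: cvg_trans (ch _ tab); apply: near_eq_cvg.
    have := @near_off_seq [::] a b t tab isT; apply: filterS => u [uab _].
    by rewrite fE.
  - rewrite {2}/f lexx; apply: cvg_trans hl; apply: near_eq_cvg.
    near=> u; rewrite fE //; apply/andP; split; near: u.
      exact: nbhs_right_gt.
    exact: nbhs_right_lt.
  - rewrite {2}/f lexx leNgt ab /=; apply: cvg_trans hr; apply: near_eq_cvg.
    near=> u; rewrite fE //; apply/andP; split; near: u.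
      exact: nbhs_left_gt.
    exact: nbhs_left_lt.
have [c1 _ h1] := EVT_max (ltW ab) cf; have [c2 _ h2] := EVT_min (ltW ab) cf.
exists (`|f c1| + `|f c2|) => t tab; rewrite -fE //.
have := h1 t; have := h2 t; rewrite !in_itv /=.
have -> : a <= t <= b by case/andP: tab => ? ?; rewrite !ltW.
move=> /(_ isT) l2 /(_ isT) l1.
have := ler_norm (f c1); have := ler_norm (- f c2); rewrite normrN.
have := normr_ge0 (f c1); have := normr_ge0 (f c2).
move: l1 l2; clear; rewrite ler_norml => *; apply/andP; split; lra.
Unshelve. all: by end_near. Qed.

Lemma mem_piece (x t : R) (p : seq R) : path <%R x p -> x < t < last x p -> t \notin p ->
  exists2 i, (i < size p)%N & nth 0 (x :: p) i < t < nth 0 (x :: p) i.+1.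
Proof.
elim: p x => [|y p IH] x /=; first by move=> _ /andP[/lt_trans h /h]; rewrite ltxx.
case/andP=> xy yp /andP[xt tl]; rewrite inE negb_or => /andP[ty tp].
case: (ltgtP t y) ty => // [ty|yt] _.
  by exists 0%N => //=; rewrite xt ty.
have [|i ip hi] := IH _ yp _ tp; first by rewrite yt.
by exists i.+1.
Qed.

Lemma piecewise_C1_pw_smooth h : piecewise_C1 h -> pw_smooth h.
Proof.
move=> [ch [p [pp lp hp]]].
have pathlt : forall i, (i < size p)%N -> nth 0 (0 :: p) i < nth 0 (0 :: p) i.+1.
  exact/pathP.
have [M hM] : exists M : R, forall i, (i < size p)%N -> forall t,
    nth 0 (0 :: p) i < t < nth 0 (0 :: p) i.+1 -> `|derive1 h t| <= M.
  elim: (size p) pathlt hp => [|n IH] lt hp; first by exists 0.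
  have [i ip|i ip|M hM] := IH; [exact/lt/ltnW|exact/hp/ltnW|].
  have [N hN] := C1_bounded (lt n (ltnSn n)) (hp n (ltnSn n)).
  exists (Num.max M N) => i; rewrite ltnS leq_eqVlt => /orP[/eqP->|ip] t ht.
    by rewrite le_max hN // orbT.
  by rewrite le_max (hM i).
split => //; exists p, M => t t01 tp.
have [|i ip ht] := mem_piece pp _ tp; first by rewrite lp.
have [d1 c1 _ _] := hp i ip.
by split; [exact: d1|exact: c1|exact: hM ip _ ht].
Qed.
End SmoothFunctions.

(** * Contour integrals along piecewise smooth curves: linearity, primitives, bounds *)

Section ContourIntegrals.
Variable R : realType.
Local Notation C := R[i].
Local Notation Re := complex.Re.
Local Notation Im := complex.Im.
Local Notation mu := (@lebesgue_measure R).
Implicit Types (g h : R -> C) (f : C -> C).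

Lemma ReD (x y : C) : Re (x + y) = Re x + Re y. Proof. by case: x; case: y. Qed.
Lemma ImD (x y : C) : Im (x + y) = Im x + Im y. Proof. by case: x; case: y. Qed.
Lemma ReN (x : C) : Re (- x) = - Re x. Proof. by case: x. Qed.
Lemma ImN (x : C) : Im (- x) = - Im x. Proof. by case: x. Qed.
Lemma ReM (x y : C) : Re (x * y) = Re x * Re y - Im x * Im y.
Proof. by case: x; case: y. Qed.
Lemma ImM (x y : C) : Im (x * y) = Re x * Im y + Im x * Re y.
Proof. by case: x; case: y. Qed.
Lemma ReV (x : C) : Re x^-1 = Re x * (Re x ^+ 2 + Im x ^+ 2)^-1.
Proof. by case: x. Qed.
Lemma ImV (x : C) : Im x^-1 = - (Im x * (Re x ^+ 2 + Im x ^+ 2)^-1).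
Proof. by case: x. Qed.
Definition ReImE := (ReD, ImD, ReN, ImN, ReM, ImM).

Lemma sqrnorm_neq0 (x : C) : x != 0 -> Re x ^+ 2 + Im x ^+ 2 != 0.
Proof.
case: x => a b; apply: contraNneq => /= /eqP.
by rewrite paddr_eq0 ?sqr_ge0 // !sqrf_eq0 => /andP[/eqP-> /eqP->].
Qed.

Lemma complexP (x y : C) : Re x = Re y -> Im x = Im y -> x = y.
Proof. by case: x => a b; case: y => c d /= -> ->. Qed.

Definition smooth_curve h := pw_smooth (fun t => Re (h t)) /\ pw_smooth (fun t => Im (h t)).

Lemma smooth_curve_cst (c : C) : smooth_curve (fun=> c).
Proof. by split; exact: pw_smooth_cst. Qed.

Lemma smooth_curveD h h' : smooth_curve h -> smooth_curve h' ->
  smooth_curve (fun t => h t + h' t).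
Proof.
move=> [a b] [c d]; split.
  by under eq_fun do rewrite ReD; exact: pw_smoothD.
by under eq_fun do rewrite ImD; exact: pw_smoothD.
Qed.

Lemma smooth_curveM h h' : smooth_curve h -> smooth_curve h' ->
  smooth_curve (fun t => h t * h' t).
Proof.
move=> [a b] [c d]; split.
  under eq_fun do rewrite ReM.
  by apply: pw_smoothD; [|apply: pw_smoothN]; exact: pw_smoothM.
by under eq_fun do rewrite ImM; apply: pw_smoothD; exact: pw_smoothM.
Qed.

Lemma smooth_curveV h : smooth_curve h -> (forall t : R, 0 <= t <= 1 -> h t != 0) ->
  smooth_curve (fun t => (h t)^-1).
Proof.
move=> [a b] nz.
have c : pw_smooth (fun t => (Re (h t) ^+ 2 + Im (h t) ^+ 2)^-1).
  apply: pw_smoothV; last by move=> t t01; exact/sqrnorm_neq0/nz.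
  under eq_fun do rewrite !expr2.
  by apply: pw_smoothD; exact: pw_smoothM.
split.
  by under eq_fun do rewrite ReV; exact: pw_smoothM.
by under eq_fun do rewrite ImV; apply: pw_smoothN; exact: pw_smoothM.
Qed.

Definition eq_off_seq (u v : R -> C) :=
  exists D : seq R, forall t : R, 0 <= t <= 1 -> t \notin D -> u t = v t.

Lemma smooth_curve_derive h : smooth_curve h -> exists D : seq R, forall t : R, 0 <= t <= 1 ->
  t \notin D -> is_derive t 1 (fun t => Re (h t)) (Re (velocity h t)) /\
                is_derive t 1 (fun t => Im (h t)) (Im (velocity h t)).
Proof.
move=> [a b]; have [D [M hD]] := pw_smoothE a; have [E [N hE]] := pw_smoothE b.
exists [:: 0, 1 & D ++ E] => t /andP[t0 t1].
rewrite !inE mem_cat !negb_or => /and4P[tn0 tn1 tD tE].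
have t01 : 0 < t < 1 by rewrite !lt_neqAle t0 t1 eq_sym tn0 tn1.
by have [? _ _ _] := hD _ t01 tD; have [? _ _ _] := hE _ t01 tE.
Qed.

Lemma velocity_is_derive h (t u v : R) : is_derive t 1 (fun t => Re (h t)) u ->
  is_derive t 1 (fun t => Im (h t)) v -> velocity h t = u +i* v.
Proof. by move=> du dv; rewrite /velocity !derive1E !derive_val. Qed.

Lemma velocityM h h' : smooth_curve h -> smooth_curve h' ->
  eq_off_seq (velocity (fun t => h t * h' t))
             (fun t => h t * velocity h' t + h' t * velocity h t).
Proof.
move=> /smooth_curve_derive[D hD] /smooth_curve_derive[E hE]; exists (D ++ E) => t t01.
rewrite mem_cat negb_or => /andP[tD tE].
have [d1 d2] := hD _ t01 tD; have [d3 d4] := hE _ t01 tE.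
move: (is_deriveM d1 d3) (is_deriveM d2 d4) (is_deriveM d1 d4) (is_deriveM d2 d3).
move=> d13 d24 d14 d23; have dr := is_deriveB d13 d24; have di := is_deriveD d14 d23.
have Er : (fun t => Re (h t * h' t)) = (fun t => Re (h t)) * (fun t => Re (h' t)) -
    (fun t => Im (h t)) * (fun t => Im (h' t)) by apply/funext => u; exact: ReM.
have Ei : (fun t => Im (h t * h' t)) = (fun t => Re (h t)) * (fun t => Im (h' t)) +
    (fun t => Im (h t)) * (fun t => Re (h' t)) by apply/funext => u; exact: ImM.
rewrite -Er in dr; rewrite -Ei in di; have -> := velocity_is_derive dr di.
by apply: complexP; rewrite !ReImE /= /GRing.scale /=; ring.
Qed.

Lemma velocityD_cst h (c : C) : smooth_curve h ->
  eq_off_seq (velocity (fun t => h t + c)) (velocity h).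
Proof.
move=> /smooth_curve_derive[D hD]; exists D => t t01 tD.
have [d1 d2] := hD _ t01 tD.
have dr := is_deriveD d1 (is_derive_cst (Re c) t (1 : R)).
have di := is_deriveD d2 (is_derive_cst (Im c) t (1 : R)).
have Er : (fun t => Re (h t + c)) = (fun t => Re (h t)) + cst (Re c).
  by apply/funext => u; exact: ReD.
have Ei : (fun t => Im (h t + c)) = (fun t => Im (h t)) + cst (Im c).
  by apply/funext => u; exact: ImD.
rewrite -Er in dr; rewrite -Ei in di; have -> := velocity_is_derive dr di.
by rewrite !addr0.
Qed.

(** Obtained by differentiating [h * h^-1 = 1] with the product rule, which avoids the quotient
    formulas for real and imaginary parts. *)
Lemma velocityV h : smooth_curve h -> (forall t : R, 0 <= t <= 1 -> h t != 0) ->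
  eq_off_seq (velocity (fun t => (h t)^-1)) (fun t => - (h t) ^- 2 * velocity h t).
Proof.
move=> sh nz; have sV := smooth_curveV sh nz.
have [D hD] := velocityM sh sV.
have [E hE] : eq_off_seq (velocity (fun t => h t * (h t)^-1)) (fun=> 0).
  exists [:: 0; 1] => t t01; rewrite !inE negb_or => /andP[t0 t1].
  have tt : 0 < t < 1 by rewrite !lt_neqAle eq_sym t0 t1.
  have key (k : C -> R) (a : R) : k 1 = a -> is_derive t 1 (fun u => k (h u * (h u)^-1)) 0.
    move=> k1; have := is_derive_cst a t (1 : R); apply: near_eq_is_derive.
    have := @near_off_seq R [::] 0 1 t tt isT; apply: filterS => u [/andP[u0 u1] _].
      by rewrite mulfV ?k1 // nz // !ltW.
  by rewrite (velocity_is_derive (key (@Re R) 1 erefl) (key (@Im R) 0 erefl)).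
exists (D ++ E) => t t01; rewrite mem_cat negb_or => /andP[tD tE].
have := hD _ t01 tD; rewrite hE // => /esym /eqP; rewrite addr_eq0 => /eqP h1.
have nzt := nz _ t01.
apply: (mulfI nzt); rewrite h1; field; exact: nzt.
Qed.

Definition cont01 (k : R -> R) := {within `[0, 1], continuous k}.

Lemma cont01_cst (c : R) : cont01 (fun=> c).
Proof. by move=> t; exact: cvg_cst. Qed.

Lemma cont01D (k l : R -> R) : cont01 k -> cont01 l -> cont01 (fun t => k t + l t).
Proof. by move=> a b t; apply: cvgD; [exact: a|exact: b]. Qed.

Lemma cont01N (k : R -> R) : cont01 k -> cont01 (fun t => - k t).
Proof. by move=> a t; apply: cvgN; exact: a. Qed.

Lemma cont01M (k l : R -> R) : cont01 k -> cont01 l -> cont01 (fun t => k t * l t).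
Proof. by move=> a b t; apply: cvgM; [exact: a|exact: b]. Qed.

Definition contour_cont g f :=
  cont01 (fun t => Re (f (g t))) /\ cont01 (fun t => Im (f (g t))).

Lemma contour_cont_cst g (c : C) : contour_cont g (fun=> c).
Proof. by split; exact: cont01_cst. Qed.

Lemma contour_cont_id g : smooth_curve g -> contour_cont g id.
Proof. by case=> -[a _] [b _]. Qed.

Lemma contour_contD g f f' : contour_cont g f -> contour_cont g f' ->
  contour_cont g (fun u => f u + f' u).
Proof.
move=> [a b] [c d]; split.
  by under eq_fun do rewrite ReD; exact: cont01D.
by under eq_fun do rewrite ImD; exact: cont01D.
Qed.

Lemma contour_contM g f f' : contour_cont g f -> contour_cont g f' ->
  contour_cont g (fun u => f u * f' u).
Proof.
move=> [a b] [c d]; split.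
  under eq_fun do rewrite ReM.
  by apply: cont01D; [|apply: cont01N]; exact: cont01M.
by under eq_fun do rewrite ImM; apply: cont01D; exact: cont01M.
Qed.

Lemma contour_contV g f : contour_cont g f -> (forall z, trace g z -> f z != 0) ->
  contour_cont g (fun u => (f u)^-1).
Proof.
move=> [a b] nz.
have c : cont01 (fun t => (Re (f (g t)) ^+ 2 + Im (f (g t)) ^+ 2)^-1).
  apply: within_continuousV; rewrite -/(cont01 _).
    under eq_fun do rewrite !expr2.
    by apply: cont01D; exact: cont01M.
  by move=> t t01; apply/sqrnorm_neq0/nz; exists t => //=; rewrite in_itv.
split.
  by under eq_fun do rewrite ReV; exact: cont01M.
by under eq_fun do rewrite ImV; apply: cont01N; exact: cont01M.
Qed.

(** The value is bundled with boundedness and measurability of [f] along [g]; without them [oint]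
    would not be additive. *)
Definition has_oint g f (v : C) :=
  [/\ bdd_meas (fun t => Re (f (g t))), bdd_meas (fun t => Im (f (g t))) & oint g f = v].

Lemma bdd_meas_velocity g : smooth_curve g ->
  bdd_meas (fun t => Re (velocity g t)) /\ bdd_meas (fun t => Im (velocity g t)).
Proof. by move=> [a b]; split; exact: bdd_meas_derive1. Qed.

Lemma bdd_meas_integrand g f v : smooth_curve g -> has_oint g f v ->
  bdd_meas (fun t => Re (f (g t) * velocity g t)) /\
  bdd_meas (fun t => Im (f (g t) * velocity g t)).
Proof.
move=> /bdd_meas_velocity[a b] [c d _]; split.
  under eq_fun do rewrite ReM.
  by apply: bdd_measD; [|apply: bdd_measN]; exact: bdd_measM.
by under eq_fun do rewrite ImM; apply: bdd_measD; exact: bdd_measM.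
Qed.

Lemma contour_cont_has_oint g f : contour_cont g f -> has_oint g f (oint g f).
Proof. by move=> [a b]; split => //; exact: bdd_meas_continuous. Qed.

Lemma has_ointD g f f' v v' : smooth_curve g -> has_oint g f v -> has_oint g f' v' ->
  has_oint g (fun u => f u + f' u) (v + v').
Proof.
move=> sg hf hf'; have [a b] := bdd_meas_integrand sg hf.
have [c d] := bdd_meas_integrand sg hf'.
case: hf hf' => [hf1 hf2 <-] [hf1' hf2' <-]; split.
- by under eq_fun do rewrite ReD; exact: bdd_measD.
- by under eq_fun do rewrite ImD; exact: bdd_measD.
rewrite /oint -mulrDr; congr (_ * _).
rewrite /contour_integral; apply: complexP; rewrite ?ReD ?ImD /=.
  under eq_Rintegral do rewrite mulrDl ReD.
  by rewrite RintegralD //; exact: bdd_meas_integrable.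
under eq_Rintegral do rewrite mulrDl ImD.
by rewrite RintegralD //; exact: bdd_meas_integrable.
Qed.

Lemma has_ointZ g f v (c : C) : smooth_curve g -> has_oint g f v ->
  has_oint g (fun u => c * f u) (c * v).
Proof.
move=> sg hf; have [a b] := bdd_meas_integrand sg hf.
have cM (x : R) k := @bdd_measM R (fun=> x) k (bdd_meas_cst x).
case: hf => [hf1 hf2 <-]; split.
- under eq_fun do rewrite ReM; apply: bdd_measD; first exact: cM.
  by apply: bdd_measN; exact: cM.
- by under eq_fun do rewrite ImM; apply: bdd_measD; exact: cM.
rewrite /oint mulrCA; congr (_ * _).
rewrite /contour_integral; apply: complexP; rewrite ?ReM ?ImM /=.
  under eq_Rintegral do rewrite -mulrA ReM.
  rewrite RintegralB //; try by apply: bdd_meas_integrable; exact: cM.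
  by rewrite !RintegralZl //; exact: bdd_meas_integrable.
under eq_Rintegral do rewrite -mulrA ImM.
rewrite RintegralD //; try by apply: bdd_meas_integrable; exact: cM.
by rewrite !RintegralZl //; exact: bdd_meas_integrable.
Qed.

Lemma has_oint_sum g (I : Type) (r : seq I) (F : I -> C -> C) (V : I -> C) :
  smooth_curve g -> (forall i, has_oint g (F i) (V i)) ->
  has_oint g (fun u => \sum_(i <- r) F i u) (\sum_(i <- r) V i).
Proof.
move=> sg hF; elim: r => [|i r IH].
  under eq_fun do rewrite big_nil.
  have := has_ointZ 0 sg (contour_cont_has_oint (contour_cont_cst g 0)).
  by rewrite big_nil !mul0r.
under eq_fun do rewrite big_cons; rewrite big_cons.
exact: has_ointD.
Qed.

(** Each value is taken at most once on [0, 1[; the endpoint 1 is not covered by injectivity and is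
    put in the list separately. *)
Lemma preimage_seq g (N : seq C) : {in `[0, 1[ &, injective g} ->
  exists D : seq R, forall t : R, 0 <= t <= 1 -> t \notin D -> g t \notin N.
Proof.
move=> ig; elim: N => [|c N [D hD]]; first by exists [::].
have [[t0 [t00 gt0]]|nex] := pselect (exists t0 : R, (0 <= t0 < 1) /\ g t0 = c).
  exists [:: 1, t0 & D] => t /andP[t0' t1]; rewrite !inE !negb_or => /and3P[n1 nt0 nD].
  rewrite hD ?t0' // andbT; apply: contra_neq nt0; rewrite -gt0; apply: ig => //.
  by rewrite in_itv /= t0' lt_neqAle n1.
exists [:: 1 & D] => t /andP[t0' t1]; rewrite !inE !negb_or => /andP[n1 nD].
rewrite hD ?t0' // andbT; apply/eqP => gtc; apply: nex; exists t; split => //.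
by rewrite t0' lt_neqAle n1.
Qed.

Lemma has_oint_eq_off g f f' v (N : seq C) : smooth_curve g -> {in `[0, 1[ &, injective g} ->
  (forall z, trace g z -> z \notin N -> f z = f' z) -> has_oint g f v -> has_oint g f' v.
Proof.
move=> sg ig ff' hf; have [D hD] := preimage_seq N ig.
have E (t : R) : 0 <= t <= 1 -> t \notin D -> f (g t) = f' (g t).
  by move=> t01 tD; apply: ff' (hD _ t01 tD); exists t => //=; rewrite in_itv.
have [a b] := bdd_meas_integrand sg hf.
case: hf => [hf1 hf2 <-]; split.
- by apply: (bdd_meas_eq_off (D := D) _ hf1) => t t01 tD; rewrite -E.
- by apply: (bdd_meas_eq_off (D := D) _ hf2) => t t01 tD; rewrite -E.
rewrite /oint; congr (_ * _); rewrite /contour_integral; apply: complexP => /=.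
  by apply/esym/(Rintegral_eq_off (D := D)) => // t t01 tD; rewrite E.
by apply/esym/(Rintegral_eq_off (D := D)) => // t t01 tD; rewrite E.
Qed.

Lemma has_oint_eq g f f' v : (forall z, trace g z -> f z = f' z) ->
  smooth_curve g -> {in `[0, 1[ &, injective g} -> has_oint g f v -> has_oint g f' v.
Proof. by move=> ff' sg ig; apply: (has_oint_eq_off (N := [::])) => // z tz _; exact: ff'. Qed.

Lemma has_oint_primitive g h f : smooth_curve g -> smooth_curve h -> h 0 = h 1 ->
  contour_cont g f -> eq_off_seq (velocity h) (fun t => f (g t) * velocity g t) ->
  has_oint g f 0.
Proof.
move=> sg sh h01 cf [D hD]; have := contour_cont_has_oint cf.
suff -> : oint g f = 0 by [].
have [a b] := bdd_meas_velocity sh.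
have E1 := @Rintegral_eq_off R D _ (fun t => Re (f (g t) * velocity g t)) _ a.
have E2 := @Rintegral_eq_off R D _ (fun t => Im (f (g t) * velocity g t)) _ b.
rewrite /oint /contour_integral -E1 -?E2; try by move=> t t01 tD; rewrite hD.
by rewrite /velocity /= !Rintegral_derive1 ?h01 ?subrr ?mulr0 //; case: sh.
Qed.

Lemma oint_bound g : smooth_curve g -> exists2 K : R, 0 <= K &
  forall f v (M : R), has_oint g f v ->
  (forall z, trace g z -> `|Re (f z)| <= M /\ `|Im (f z)| <= M) ->
  `|Re (contour_integral g f)| <= K * M /\ `|Im (contour_integral g f)| <= K * M.
Proof.
move=> sg; have [[_ [A hA]] [_ [B hB]]] := bdd_meas_velocity sg.
have A0 : 0 <= A by apply: le_trans (hA 0 _); rewrite ?lexx ?ler01.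
have B0 : 0 <= B by apply: le_trans (hB 0 _); rewrite ?lexx ?ler01.
exists (A + B); first exact: addr_ge0.
move=> f' v M hf hM; have [a b] := bdd_meas_integrand sg hf.
have tr t : 0 <= t <= 1 -> trace g (g t) by move=> t01; exists t => //=; rewrite in_itv.
split; apply: Rintegral_le_bound => // t t01.
  have [h1 h2] := hM _ (tr _ t01); rewrite ReM mulrDl.
  apply: (le_trans (ler_normB _ _)); rewrite !normrM ![_ * M]mulrC.
  by apply: lerD; apply: ler_pM => //; [exact: hA|exact: hB].
have [h1 h2] := hM _ (tr _ t01); rewrite ImM mulrDl [_ * M + _]addrC.
apply: (le_trans (ler_normD _ _)); rewrite !normrM ![_ * M]mulrC.
by apply: lerD; apply: ler_pM => //; [exact: hB|exact: hA].
Qed.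
End ContourIntegrals.

(** * Integrals of rational functions whose poles all have the same winding number *)

Section RationalIntegrals.
Variable R : realType.
Local Notation C := R[i].
Implicit Types (g h : R -> C) (f r : C -> C) (N : {poly C}) (ps : seq C).

Definition closed_curve g :=
  [/\ smooth_curve g, g 0 = g 1 & {in `[0, 1[ &, injective g}].

Lemma simple_closed_curve_closed g : simple_closed_curve g -> closed_curve g.
Proof. by move=> [a b c d]; split => //; split; exact: piecewise_C1_pw_smooth. Qed.

Lemma smooth_curveX h n : smooth_curve h -> smooth_curve (fun t => h t ^+ n).
Proof.
move=> sh; elim: n => [|n IH].
  by under eq_fun do rewrite expr0; exact: smooth_curve_cst.
by under eq_fun do rewrite exprS; exact: smooth_curveM.
Qed.

Lemma velocityX h n : smooth_curve h ->
  eq_off_seq (velocity (fun t => h t ^+ n.+1)) (fun t => n.+1%:R * h t ^+ n * velocity h t).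
Proof.
move=> sh; elim: n => [|n [D hD]].
  exists [::] => t _ _; rewrite expr0 mulr1 mul1r.
  by under [X in velocity X]eq_fun do rewrite expr1.
have [E hE] := velocityM sh (smooth_curveX n.+1 sh).
exists (D ++ E) => t t01; rewrite mem_cat negb_or => /andP[tD tE].
under [X in velocity X]eq_fun do rewrite exprS.
rewrite hE // hD // -[in RHS]natr1 !exprS; ring.
Qed.

Lemma contour_contX g f n : contour_cont g f -> contour_cont g (fun u => f u ^+ n).
Proof.
move=> cf; elim: n => [|n IH].
  by under eq_fun do rewrite expr0; exact: contour_cont_cst.
by under eq_fun do rewrite exprS; exact: contour_contM.
Qed.

Lemma oint_X g n : closed_curve g -> has_oint g (fun u => u ^+ n) 0.
Proof.
move=> [sg g01 ig].
have nz : n.+1%:R != 0 :> C by rewrite pnatr_eq0.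
have h1 : has_oint g (fun u => n.+1%:R * u ^+ n) 0.
  apply: (has_oint_primitive (h := fun t => g t ^+ n.+1)) => //.
  - exact: smooth_curveX.
  - by rewrite g01.
  - apply: contour_contM; first exact: contour_cont_cst.
    by apply: contour_contX; exact: contour_cont_id.
  - exact: velocityX.
have := has_ointZ (n.+1%:R^-1) sg h1; rewrite mulr0.
by apply: has_oint_eq => // z _; rewrite mulKf.
Qed.

Lemma oint_poly g N : closed_curve g -> has_oint g (fun u => N.[u]) 0.
Proof.
move=> cg; have [sg _ ig] := cg.
have H : has_oint g (fun u => \sum_(i < size N) N`_i * u ^+ i) (\sum_(i < size N) 0).
  apply: (@has_oint_sum R g _ _ (fun (i : 'I_(size N)) u => N`_i * u ^+ i) (fun=> 0)) => // i.
  by have := has_ointZ N`_i sg (oint_X i cg); rewrite mulr0.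
rewrite big1 // in H; apply: has_oint_eq H => // z _.
by rewrite horner_coef.
Qed.

Lemma contour_cont_sub g (p : C) : closed_curve g -> contour_cont g (fun u => u - p).
Proof.
move=> [sg _ _]; apply: contour_contD; first exact: contour_cont_id.
exact: contour_cont_cst.
Qed.

Lemma trace_sub_neq0 g (p z : C) : ~ trace g p -> trace g z -> z - p != 0.
Proof. by move=> np tz; rewrite subr_eq0; apply/eqP => zp; apply: np; rewrite -zp. Qed.

(** The exponent is at most -2, so the primitive is again a power of [u - p]. *)
Lemma oint_Vpow g (p : C) n : closed_curve g -> ~ trace g p ->
  has_oint g (fun u => (u - p) ^- n.+2) 0.
Proof.
move=> cg np; have [sg g01 ig] := cg.
have nzg t : 0 <= t <= 1 -> g t - p != 0.
  by move=> t01; apply: (trace_sub_neq0 np); exists t => //=; rewrite in_itv.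
have sh : smooth_curve (fun t => g t - p).
  by apply: smooth_curveD => //; exact: smooth_curve_cst.
have sk := smooth_curveV sh nzg.
have nz : - n.+1%:R != 0 :> C by rewrite oppr_eq0 pnatr_eq0.
have h1 : has_oint g (fun u => - n.+1%:R * (u - p)^-1 ^+ n.+2) 0.
  apply: (has_oint_primitive (h := fun t => (g t - p)^-1 ^+ n.+1)) => //.
  - exact: smooth_curveX.
  - by rewrite g01.
  - apply: contour_contM; first exact: contour_cont_cst.
    apply: contour_contX; apply: contour_contV; first exact: contour_cont_sub.
    by move=> z tz; exact: (trace_sub_neq0 np tz).
  have [D hD] := velocityX n sk; have [E hE] := velocityV sh nzg.
  have [F hF] := velocityD_cst (- p) sg.
  exists (D ++ E ++ F) => t t01; rewrite !mem_cat !negb_or => /and3P[tD tE tF].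
  by rewrite hD // hE // hF // -exprVn !exprS; ring.
have := has_ointZ ((- n.+1%:R)^-1) sg h1; rewrite mulr0.
by apply: has_oint_eq => // z _; rewrite mulKf // exprVn.
Qed.

Lemma oint_winding g (p : C) : closed_curve g -> ~ trace g p ->
  has_oint g (fun u => (u - p)^-1) (winding_number g p).
Proof.
move=> cg np; apply: contour_cont_has_oint; apply: contour_contV.
  exact: contour_cont_sub.
by move=> z tz; exact: (trace_sub_neq0 np tz).
Qed.

Lemma prod_trace_neq0 g ps (z : C) : (forall p, p \in ps -> ~ trace g p) ->
  trace g z -> \prod_(p <- ps) (z - p) != 0.
Proof.
move=> hps tz; rewrite prodf_seq_neq0; apply/allP => p pps /=.
exact: trace_sub_neq0 (hps _ pps) tz.
Qed.

(* Partial fractions: two distinct poles are separated through the difference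
   quotient, whose two terms have the same integral by induction. *)
Lemma oint_Vprod g ps (w : C) : closed_curve g ->
  (forall p, p \in ps -> ~ trace g p /\ winding_number g p = w) -> ps != [::] ->
  has_oint g (fun u => (\prod_(p <- ps) (u - p))^-1) (w * (size ps == 1)%:R).
Proof.
move=> cg; have [sg _ ig] := cg.
move: {2}(size ps) (leqnn (size ps)) => n.
elim: n ps => [|n IH] [|p ps] //= sps hps _.
case: ps sps hps => [|p1 ps] /= sps hps.
  have [np <-] := hps p (mem_head _ _); rewrite mulr1.
  apply: has_oint_eq (oint_winding cg np) => // z _.
  by rewrite big_seq1.
rewrite mulr0; have [np _] := hps p (mem_head _ _).
have [eqp|] := boolP (all (pred1 p) (p1 :: ps)).
  move/all_pred1P : eqp => ->.
  apply: has_oint_eq (oint_Vpow (size ps) cg np) => // z _.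
  by rewrite big_cons big_nseq iter_mulr_1 -exprS. 
rewrite -has_predC => /hasP[p' p'in /= np'].
have pe := perm_to_rem p'in.
set rest := rem p' (p1 :: ps) in pe.
have srest : size rest = size ps by rewrite size_rem.
have hrest x : x \in rest -> ~ trace g x /\ winding_number g x = w.
  by move=> /mem_rem xin; apply: hps; rewrite inE xin orbT.
have hp' : ~ trace g p' /\ winding_number g p' = w by apply: hps; rewrite inE p'in orbT.
have h1 := IH (p :: rest); have h2 := IH (p' :: rest); rewrite /= srest in h1 h2.
have H1 : has_oint g (fun u => (\prod_(j <- p :: rest) (u - j))^-1)
   (w * ((size ps).+1 == 1)%:R).
  apply: h1 => // x; rewrite inE => /orP[/eqP->|]; [exact: hps (mem_head _ _)|exact: hrest].
have H2 : has_oint g (fun u => (\prod_(j <- p' :: rest) (u - j))^-1)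
   (w * ((size ps).+1 == 1)%:R).
  by apply: h2 => // x; rewrite inE => /orP[/eqP->|]; [|exact: hrest].
have := has_ointZ (p - p')^-1 sg (has_ointD sg H1 (has_ointZ (-1) sg H2)).
rewrite mulN1r subrr mulr0; apply: has_oint_eq => // z tz.
rewrite [in RHS]big_cons [in RHS](perm_big _ pe) !big_cons /=.
have nz1 := trace_sub_neq0 np tz; have nz2 := trace_sub_neq0 hp'.1 tz.
have nz3 : \prod_(j <- rest) (z - j) != 0.
  by apply: (prod_trace_neq0 (g := g)) => // x /hrest[].
have nz4 : p - p' != 0 by rewrite subr_eq0 eq_sym.
field; by rewrite nz1 nz2 nz3 nz4.
Qed.

Lemma poly_divX (N : {poly C}) (p : C) : exists2 M : {poly C},
  N = (N.[p])%:P + M * ('X - p%:P) & (size M <= (size N).-1)%N.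
Proof.
have /factor_theorem[M hM] : root (N - (N.[p])%:P) p.
  by rewrite /root !hornerE subrr.
exists M; first by rewrite -hM addrC subrK.
have [->|Mn0] := eqVneq M 0; first by rewrite size_poly0.
have := size_Mmonic Mn0 (monicXsubC p); rewrite -hM size_XsubC addn2 /= => sz.
have: (size (N - (N.[p])%:P)%R <= size N)%N.
  have [N0|Nn0] := eqVneq N 0; first by rewrite N0 horner0 polyC0 subr0.
  apply: (leq_trans (size_polyD _ _)); rewrite geq_max leqnn size_polyN.
  by apply: (leq_trans (size_polyC_leq1 _)); rewrite size_poly_gt0.
by rewrite sz; case: (size N).
Qed.

(** Divide [N] by [X - p]: the quotient has one pole fewer, and the remainder [N(p)] leaves a bare
    inverse product, whose integral is nonzero only for a single pole of nonzero winding number. In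
    that case the degree condition forces [N = 0]. *)
Lemma oint_ratfun0 g ps (w : C) N : closed_curve g ->
  (forall p, p \in ps -> ~ trace g p /\ winding_number g p = w) ->
  w = 0 \/ (size N < size ps)%N ->
  has_oint g (fun u => N.[u] / \prod_(p <- ps) (u - p)) 0.
Proof.
move=> cg; have [sg _ ig] := cg.
elim: ps N => [|p ps IH] N hps hN.
  apply: has_oint_eq (oint_poly N cg) => // z _.
  by rewrite big_nil divr1.
have [M NE sM] := poly_divX N p.
have hM : w = 0 \/ M = 0 \/ (size M < size ps)%N.
  case: hN => [->|/= hN]; [by left|right].
  have [M0|Mn0] := eqVneq M 0; [by left|right].
  have : (0 < size M)%N by rewrite size_poly_gt0.
  by move: sM hN; case: (size N) => [|[|m]] /=; rewrite ?leqn0 ?ltnS;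
    [move/eqP->|move/eqP->|move=> h1 h2 _; exact: leq_ltn_trans h1 h2].
have h1 : has_oint g (fun u => M.[u] / \prod_(p <- ps) (u - p)) 0.
  have hps' x : x \in ps -> ~ trace g x /\ winding_number g x = w.
    by move=> xin; apply: hps; rewrite inE xin orbT.
  case: hM => [w0|[M0|sM']].
  - by apply: IH => //; left.
  - apply: has_oint_eq (oint_poly 0 cg) => // z _.
    by rewrite M0 !horner0 mul0r.
  - by apply: IH => //; right.
have h2 : has_oint g (fun u => N.[p] * (\prod_(x <- p :: ps) (u - x))^-1) 0.
  have := has_ointZ N.[p] sg (oint_Vprod cg hps isT).
  case: hN => [->|]; first by rewrite mul0r mulr0.
  case: ps {IH hps h1 hM} sM => [|p1 ps] sM /=; last by rewrite !mulr0.
  by rewrite ltnS leqn0 size_poly_eq0 => /eqP->; rewrite horner0 !mul0r.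
have := has_ointD sg h1 h2; rewrite addr0; apply: has_oint_eq => // z tz.
have nz1 : z - p != 0 by apply: (trace_sub_neq0 _ tz); case: (hps p (mem_head _ _)).
have nz2 : \prod_(j <- ps) (z - j) != 0.
  apply: (prod_trace_neq0 (g := g)) => // x xin.
  by have /hps[] : x \in p :: ps by rewrite inE xin orbT.
have NZ : N.[z] = N.[p] + M.[z] * (z - p) by rewrite {1}NE !hornerE.
rewrite NZ big_cons; field.
by rewrite nz1 nz2.
Qed.

(** The fraction need not be reduced, and the equation is required at the poles too, where both
    sides follow the convention for dividing by zero. Products then concatenate pole lists with no
    side condition. *)
Definition ratfun (P : set C) f := exists N ps, (forall p, p \in ps -> P p) /\
  forall u, f u = N.[u] / \prod_(p <- ps) (u - p).

Definition ratfun_proper (P : set C) f := exists N ps, [/\ forall p, p \in ps -> P p,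
  (size N <= (size ps).+1)%N & forall u, f u = N.[u] / \prod_(p <- ps) (u - p)].

(** As [size N] exceeds the degree by one, the strict inequality puts the degree of a nonzero [N] at
    least 2 below the number of poles: decay like [u^-2], hence no residue at infinity. *)
Definition ratfun_decay (P : set C) f := exists N ps, [/\ forall p, p \in ps -> P p,
  (size N < size ps)%N & forall u, f u = N.[u] / \prod_(p <- ps) (u - p)].

Lemma ratfun_properW P f : ratfun_proper P f -> ratfun P f.
Proof. by move=> [N [ps [a _ b]]]; exists N, ps. Qed.

Lemma ratfun_decayW P f : ratfun_decay P f -> ratfun P f.
Proof. by move=> [N [ps [a _ b]]]; exists N, ps. Qed.

Lemma ratfun_sub (P Q : set C) f : P `<=` Q -> ratfun P f -> ratfun Q f.
Proof. by move=> PQ [N [ps [a b]]]; exists N, ps; split => // p /a /PQ. Qed.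

Lemma ratfun_poly P N : ratfun P (fun u => N.[u]).
Proof. by exists N, [::]; split => // u; rewrite big_nil divr1. Qed.

Lemma ratfun_cst P (c : C) : ratfun P (fun=> c).
Proof. by have := ratfun_poly P c%:P; under eq_fun do rewrite hornerC. Qed.

Lemma ratfun_affine P (a b : C) : ratfun P (fun u => a + b * u).
Proof.
have := ratfun_poly P (a%:P + b *: 'X); congr ratfun; apply/funext => u.
by rewrite !hornerE.
Qed.

Lemma ratfunM P f f' : ratfun P f -> ratfun P f' -> ratfun P (fun u => f u * f' u).
Proof.
move=> [N [ps [a b]]] [N' [ps' [a' b']]]; exists (N * N'), (ps ++ ps'); split.
  by move=> p; rewrite mem_cat => /orP[/a|/a'].
by move=> u; rewrite b b' big_cat hornerM /= invfM mulrACA.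
Qed.

Lemma ratfun_properM P f f' : ratfun_proper P f -> ratfun_proper P f' ->
  ratfun_proper P (fun u => f u * f' u).
Proof.
move=> [N [ps [a s b]]] [N' [ps' [a' s' b']]]; exists (N * N'), (ps ++ ps'); split.
- by move=> p; rewrite mem_cat => /orP[/a|/a'].
- by rewrite size_cat; have := size_polyMleq N N'; lia.
- by move=> u; rewrite b b' big_cat hornerM /= invfM mulrACA.
Qed.

Lemma ratfun_decayM P f f' : ratfun_decay P f -> ratfun_proper P f' ->
  ratfun_decay P (fun u => f u * f' u).
Proof.
move=> [N [ps [a s b]]] [N' [ps' [a' s' b']]]; exists (N * N'), (ps ++ ps'); split.
- by move=> p; rewrite mem_cat => /orP[/a|/a'].
- by rewrite size_cat; have := size_polyMleq N N'; lia.
- by move=> u; rewrite b b' big_cat hornerM /= invfM mulrACA.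
Qed.

Lemma ratfun_prod P (I : eqType) (s : seq I) (F : I -> C -> C) :
  (forall i, i \in s -> ratfun P (F i)) -> ratfun P (fun u => \prod_(i <- s) F i u).
Proof.
elim: s => [|i s IH] hF; first by under eq_fun do rewrite big_nil; exact: ratfun_cst.
under eq_fun do rewrite big_cons; apply: ratfunM; first by apply: hF; rewrite mem_head.
by apply: IH => j js; apply: hF; rewrite inE js orbT.
Qed.

Lemma ratfun_V (P : set C) (p : C) : P p -> ratfun P (fun u => (u - p)^-1).
Proof.
exists 1, [:: p]; split; first by move=> x; rewrite inE => /eqP->.
by move=> u; rewrite hornerE big_seq1 mul1r.
Qed.

Lemma ratfun_proper_moebius (P : set C) (a b p : C) : P p ->
  ratfun_proper P (fun u => (a * u + b) / (u - p)).
Proof.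
exists (a *: 'X + b%:P), [:: p]; split; first by move=> x; rewrite inE => /eqP->.
  apply: (leq_trans (size_polyD _ _)); rewrite geq_max /=; apply/andP; split.
    by apply: (leq_trans (size_scale_leq _ _)); rewrite size_polyX.
  by apply: (leq_trans (size_polyC_leq1 _)).
by move=> u; rewrite !hornerE big_seq1.
Qed.

Lemma ratfun_cont g P f : closed_curve g -> (forall p, P p -> ~ trace g p) -> ratfun P f ->
  contour_cont g f.
Proof.
move=> cg nP [N [ps [hps fE]]]; have [sg _ _] := cg.
have -> : f = (fun u => N.[u] * (\prod_(p <- ps) (u - p))^-1) by apply/funext.
apply: contour_contM.
  elim/poly_ind: N {fE} => [|N c IH].
    have -> : horner (0 : {poly C}) = (fun=> 0) by apply/funext => u; rewrite horner0.
    exact: contour_cont_cst.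
  have -> : horner (N * 'X + c%:P) = (fun u => N.[u] * u + c).
    by apply/funext => u; rewrite !hornerE.
  apply: contour_contD; last exact: contour_cont_cst.
  by apply: contour_contM => //; exact: contour_cont_id.
apply: contour_contV; last by move=> z; apply: prod_trace_neq0 => p /hps /nP.
elim: (ps) => [|p qs IH].
  by under eq_fun do rewrite big_nil; exact: contour_cont_cst.
under eq_fun do rewrite big_cons; apply: contour_contM => //.
exact: contour_cont_sub.
Qed.

End RationalIntegrals.

(** * Integrating out one variable *)

Section Residues.
Variable R : realType.
Local Notation C := R[i].
Implicit Types (f r : C -> C) (N : {poly C}) (ps : seq C).

(** The numerator is left free so that one shape covers the inversion factor ([a = q], [b = -1]),
    the in-block factor ([a = 1], [b = -1]) and the numerators created when a kernel is split at a
    pole. *)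
Definition kernel (q a b u v : C) : C := (a * u + b * v) / (u - q * v).

(* The class of functions of the remaining variables produced by integrating out
   one variable: each of the variables in [A] enters through proper rational
   functions with poles in [P a]. *)
Inductive sepsum (A : nat -> Prop) (P : nat -> set C) : ((nat -> C) -> C) -> Prop :=
| sepsum_cst c : sepsum A P (fun=> c)
| sepsum_add F G : sepsum A P F -> sepsum A P G ->
    sepsum A P (fun u => F u + G u)
| sepsum_mul a r F : A a -> ratfun_proper (P a) r -> sepsum A P F ->
    sepsum A P (fun u => r (u a) * F u).

Variables (g : R -> C) (I O : set C).
Hypothesis cg : closed_curve g.
Hypothesis hI : forall p, I p -> ~ trace g p /\ winding_number g p = 1.
Hypothesis hO : forall p, O p -> ~ trace g p /\ winding_number g p = 0.

Let sg : smooth_curve g. Proof. by case: cg. Qed.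
Let ig : {in `[0, 1[ &, injective g}. Proof. by case: cg. Qed.

Lemma inside_outside p p' : I p -> O p' -> p != p'.
Proof.
move=> /hI[_ w1] /hO[_ w0]; apply: contra_eq_neq w1 => ->.
by rewrite w0 eq_sym oner_neq0.
Qed.

Lemma oint_outside f : ratfun O f -> has_oint g f 0.
Proof.
move=> [N [ps [hps fE]]].
have H : has_oint g (fun u => N.[u] / \prod_(p <- ps) (u - p)) 0.
  by apply: (@oint_ratfun0 R g ps 0 N cg); [move=> p /hps /hO|left].
by apply: has_oint_eq H => // z _; rewrite fE.
Qed.

Lemma oint_inside f : ratfun_decay I f -> has_oint g f 0.
Proof.
move=> [N [ps [hps sN fE]]].
have H : has_oint g (fun u => N.[u] / \prod_(p <- ps) (u - p)) 0.
  by apply: (@oint_ratfun0 R g ps 1 N cg); [move=> p /hps /hI|right].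
by apply: has_oint_eq H => // z _; rewrite fE.
Qed.

(** For [f = N / D] the difference quotient at [p] has the numerator [D(p) N - N(p) D], divisible by
    [X - p]; so it acquires no pole at [p]. *)
Lemma ratfun_divX f p : ratfun O f -> ~ O p -> exists2 f1, ratfun O f1 &
  forall u, ~ O u -> f u = f p + (u - p) * f1 u.
Proof.
move=> [N [ps [hps fE]]] nOp.
have nz u : ~ O u -> \prod_(x <- ps) (u - x) != 0.
  move=> nOu; rewrite prodf_seq_neq0; apply/allP => x xps /=; rewrite subr_eq0.
  by apply/eqP => ux; apply: nOu; rewrite ux; exact: hps.
pose D := \prod_(x <- ps) ('X - x%:P) : {poly C}.
have DE u : D.[u] = \prod_(x <- ps) (u - x).
  by rewrite /D horner_prod; apply: eq_bigr => x _; rewrite !hornerE.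
have /factor_theorem[M hM] : root ((D.[p])%:P * N - (N.[p])%:P * D) p.
  by rewrite /root !hornerE mulrC subrr.
exists (fun u => (D.[p])^-1 * (M.[u] / \prod_(x <- ps) (u - x))).
  by apply: ratfunM; [exact: ratfun_cst|exists M, ps].
move=> u nOu; rewrite !fE -!DE.
have h : D.[p] * N.[u] - N.[p] * D.[u] = M.[u] * (u - p).
  by have := congr1 (horner^~ u) hM; rewrite !hornerE.
have nzu : D.[u] != 0 by rewrite DE nz.
have nzp : D.[p] != 0 by rewrite DE nz.
have -> : N.[u] = (M.[u] * (u - p) + N.[p] * D.[u]) / D.[p].
  by rewrite -h subrK mulrC mulKf.
by field; rewrite nzu nzp.
Qed.

Lemma trace_not_outside z : trace g z -> ~ O z.
Proof. by move=> tz /hO[]. Qed.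

Lemma oint_simple_pole f p : ratfun O f -> I p -> has_oint g (fun u => f u / (u - p)) (f p).
Proof.
move=> rf Ip; have nOp : ~ O p by move=> /(inside_outside Ip)/eqP.
have [f1 rf1 fE] := ratfun_divX rf nOp; have [ntp wp] := hI Ip.
have := has_ointD sg (oint_outside rf1) (has_ointZ (f p) sg (oint_winding cg ntp)).
rewrite wp mulr1 add0r; apply: has_oint_eq => // z tz.
rewrite (fE z (trace_not_outside tz)).
by field; exact: trace_sub_neq0 ntp tz.
Qed.

Variable q : C.
Hypothesis q0 : q != 0.

Lemma ratfun_kernel a b (u : C) : O (u / q) -> ratfun O (kernel q a b u).
Proof.
move=> Ou.
have -> : kernel q a b u = (fun v => (- q^-1) * ((a * u + b * v) * (v - u / q)^-1)).
  apply/funext => v; rewrite /kernel.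
  have -> : u - q * v = - q * (v - u / q) by field.
  by rewrite invfM invrN mulrCA.
apply: ratfunM; first exact: ratfun_cst.
by apply: ratfunM; [exact: ratfun_affine|exact: ratfun_V].
Qed.

(* Induction on the poles inside the contour: splitting one kernel at a pole [p]
   as its value at [p] plus a multiple of [v - p] removes either the kernel or
   the pole. *)
Lemma oint_kernels (P : nat -> set C) (U : set (nat -> C)) (A : seq (nat * (C * C)))
    (A' : nat -> Prop) (ins : seq C) f :
  ratfun O f -> (forall p, p \in ins -> I p) ->
  (forall x p, x \in A -> I p -> A' x.1 /\ P x.1 (q * p)) ->
  (forall u x, U u -> x \in A -> O (u x.1 / q)) ->
  exists2 G, sepsum A' P G & forall u, U u ->
    has_oint g (fun v => f v / \prod_(p <- ins) (v - p) *
                  \prod_(x <- A) kernel q x.2.1 x.2.2 (u x.1) v) (G u).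
Proof.
move=> rf; elim: ins A => [|p ins IHi] A hins.
  move=> _ hU; exists (fun=> 0); first exact: sepsum_cst.
  move=> u Uu; apply: oint_outside.
  apply: ratfunM; first by under eq_fun do rewrite big_nil divr1.
  by apply: ratfun_prod => x xA; apply: ratfun_kernel; exact: hU.
have Ip : I p by apply: hins; rewrite mem_head.
have hins' x : x \in ins -> I x by move=> xi; apply: hins; rewrite inE xi orbT.
elim: A => [|[a [c d]] A IHA] hP hU.
  (* With no kernel left the integral does not depend on the outer variables: it is a constant,
     whatever its value. *)
  pose F v := f v / \prod_(p <- p :: ins) (v - p).
  exists (fun=> oint g F); first exact: sepsum_cst.
  move=> u _; have : has_oint g F (oint g F).
    apply: contour_cont_has_oint.
    apply: (@ratfun_cont R g (fun x => I x \/ O x)) => //.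
      by move=> x [/hI[]|/hO[]].
    apply: ratfunM; first by apply: ratfun_sub rf => x; right.
    exists 1, (p :: ins); split; first by move=> x /hins; left.
    by move=> x; rewrite hornerE mul1r.
  by apply: has_oint_eq => // z _; rewrite big_nil mulr1.
have [|u x Uu xA|G1 sG1 h1] := IHA.
- by move=> x p' xA; apply: hP; rewrite inE xA orbT.
- by apply: hU => //; rewrite inE xA orbT.
(* The new numerator comes from [(c u + d v)/(u - q v) = (c u + d p)/(u - q p) + (v - p) (q c + d) u
   / ((u - q p) (u - q v))]: the factor [v - p] removes the pole [p], and [1/(u - q p)] goes to the
   outer variable. *)
have [|u x Uu|G2 sG2 h2] := IHi ((a, (q * c + d, 0)) :: A) hins'.
- move=> x p'; rewrite inE => /orP[/eqP-> Ip'|xA Ip'].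
    by apply: (hP (a, (c, d))) => //; rewrite mem_head.
  by apply: hP => //; rewrite inE xA orbT.
- rewrite inE => /orP[/eqP->|xA] /=.
    by apply: (hU u (a, (c, d))) => //; rewrite mem_head.
  by apply: hU => //; rewrite inE xA orbT.
have [A'a Pa] : A' a /\ P a (q * p) by apply: (hP (a, (c, d))) => //; rewrite mem_head.
exists (fun u => (fun z => (c * z + d * p) / (z - q * p)) (u a) * G1 u +
                 (fun z => (0 * z + 1) / (z - q * p)) (u a) * G2 u).
  have s1 := sepsum_mul A'a (ratfun_proper_moebius c (d * p) Pa) sG1.
  have s2 := sepsum_mul A'a (ratfun_proper_moebius 0 1 Pa) sG2.
  exact: sepsum_add s1 s2.
move=> u Uu /=.
have := has_ointD sg (has_ointZ ((c * u a + d * p) / (u a - q * p)) sg (h1 u Uu))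
   (has_ointZ ((0 * u a + 1) / (u a - q * p)) sg (h2 u Uu)).
apply: has_oint_eq => // v tv; rewrite !big_cons /= /kernel.
have Ou : O (u a / q) by apply: (hU u (a, (c, d))) => //; rewrite mem_head.
have n1 : v - p != 0 by case: (hI Ip) => np _; exact: (trace_sub_neq0 np tv).
have n2 : u a - q * p != 0.
  have /eqP := inside_outside Ip Ou; rewrite subr_eq0 => np; apply/eqP => ua.
  by apply: np; rewrite ua mulrC mulKf.
have n3 : u a - q * v != 0.
  rewrite subr_eq0; apply/eqP => ua; apply: (trace_not_outside tv).
  by rewrite -(mulKf q0 v) -ua mulrC.
have n4 : \prod_(j <- ins) (v - j) != 0.
  by apply: (prod_trace_neq0 (g := g)) => // x /hins'/hI[].
by field; rewrite n1 n2 n3 n4.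
Qed.

End Residues.

(** * Iterated integrals: vanishing criterion and the diagonal term *)

Section IteratedIntegrals.
Variable R : realType.
Local Notation C := R[i].
Variables (gam : nat -> R -> C) (K : nat).
Hypothesis cg : forall i, (i < K)%N -> closed_curve (gam i).
Implicit Types (u : nat -> C) (F G : (nat -> C) -> C).

Definition upd u m (x : C) : nat -> C := fun i => if i == m then x else u i.

Lemma updE u m x : upd u m x m = x. Proof. by rewrite /upd eqxx. Qed.
Lemma upd_lt u m x i : (i < m)%N -> upd u m x i = u i.
Proof. by rewrite /upd => /ltn_eqF->. Qed.

(* [has_iter n m u F v]: integrating [F] over the variables [m, ..., m + n - 1],
   the first one being outermost and the variables below [m] being read from [u],
   gives [v]; at each level finitely many values may be discarded. *)
Fixpoint has_iter (n m : nat) u F (v : C) : Prop :=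
  if n is n'.+1 then exists (G : C -> C) (N : seq C), has_oint (gam m) G v /\
    forall x, trace (gam m) x -> x \notin N -> has_iter n' m.+1 (upd u m x) F (G x)
  else F u = v.

Definition on_traces n u := forall i, (i < n)%N -> trace (gam i) (u i).

(** The points where the divisions by [u_a - u_b] and by [u_i] in the integrand are genuine. *)
Definition generic n u := [/\ on_traces n u, forall i j, (i < j < n)%N -> u i != u j &
  forall i, (i < n)%N -> u i != 0].

Lemma generic_upd m u x : generic m u -> trace (gam m) x ->
  x \notin 0 :: [seq u i | i <- iota 0 m] -> generic m.+1 (upd u m x).
Proof.
move=> [tu du nu] tx; rewrite inE negb_or => /andP[x0 xu]; split.
- move=> i; rewrite ltnS leq_eqVlt => /orP[/eqP->|im]; first by rewrite updE.
  by rewrite upd_lt //; exact: tu.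
- move=> i j /andP[ij]; rewrite ltnS leq_eqVlt => /orP[/eqP jm|jm].
    rewrite jm updE upd_lt -?jm //; apply: contraNneq xu => <-.
    by apply: map_f; rewrite mem_iota -jm.
  by rewrite !upd_lt // ?(ltn_trans ij) //; apply: du; rewrite ij.
- move=> i; rewrite ltnS leq_eqVlt => /orP[/eqP->|im]; first by rewrite updE.
  by rewrite upd_lt //; exact: nu.
Qed.

Lemma has_iter_eq n m u F F' v : generic m u ->
  (forall u', generic (m + n) u' -> F u' = F' u') -> has_iter n m u F v -> has_iter n m u F' v.
Proof.
elim: n m u v => [|n IH] m u v gu FF' /=; first by rewrite -FF' ?addn0.
move=> [G [N [hG hN]]]; exists G, (N ++ 0 :: [seq u i | i <- iota 0 m]); split => // x tx.
rewrite mem_cat negb_or => /andP[xN xu]; apply: IH (hN x tx xN).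
  exact: generic_upd.
by move=> u'; rewrite addSnnS; exact: FF'.
Qed.

Lemma has_iterD n m u F F' v v' : (m + n <= K)%N -> has_iter n m u F v ->
  has_iter n m u F' v' -> has_iter n m u (fun u => F u + F' u) (v + v').
Proof.
elim: n m u v v' => [|n IH] m u v v' mK /=; first by move=> -> ->.
have mK' : (m < K)%N by apply: leq_trans mK; rewrite addnS ltnS leq_addr.
have [sg _ _] := cg mK'.
move=> [G [N [hG hN]]] [G' [N' [hG' hN']]]; exists (fun x => G x + G' x), (N ++ N').
split; first exact: has_ointD.
move=> x tx; rewrite mem_cat negb_or => /andP[xN xN'].
by apply: IH; [rewrite addSnnS|exact: hN|exact: hN'].
Qed.

Lemma has_iterZ n m u F v (c : C) : (m + n <= K)%N -> has_iter n m u F v ->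
  has_iter n m u (fun u => c * F u) (c * v).
Proof.
elim: n m u v => [|n IH] m u v mK /=; first by move=> ->.
have mK' : (m < K)%N by apply: leq_trans mK; rewrite addnS ltnS leq_addr.
have [sg _ _] := cg mK'.
move=> [G [N [hG hN]]]; exists (fun x => c * G x), N; split; first exact: has_ointZ.
by move=> x tx xN; apply: IH; [rewrite addSnnS|exact: hN].
Qed.

Lemma has_iter0 n m u : (m + n <= K)%N -> has_iter n m u (fun=> 0) 0.
Proof.
elim: n m u => [//|n IH] m u mK.
have mK' : (m < K)%N by apply: leq_trans mK; rewrite addnS ltnS leq_addr.
exists (fun=> 0), [::]; split; last by move=> x _ _; apply: IH; rewrite addSnnS.
have := oint_poly 0 (cg mK'); have [sg _ ig] := cg mK'.
by apply: has_oint_eq => // z _; rewrite horner0.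
Qed.

Lemma has_iter_sum n m u (T : eqType) (s : seq T) (F : T -> (nat -> C) -> C) (V : T -> C) :
  (m + n <= K)%N -> (forall x, x \in s -> has_iter n m u (F x) (V x)) ->
  has_iter n m u (fun u => \sum_(x <- s) F x u) (\sum_(x <- s) V x).
Proof.
move=> mK; elim: s => [|x s IH] hF.
  by rewrite big_nil; under eq_fun do rewrite big_nil; exact: has_iter0.
rewrite big_cons; under eq_fun do rewrite big_cons.
apply: has_iterD => //; first by apply: hF; rewrite mem_head.
by apply: IH => y ys; apply: hF; rewrite inE ys orbT.
Qed.

(** [has_iter] unfolds from the outermost variable, whereas residues are taken innermost first; this
    peels off the last variable instead. *)
Lemma has_iter_last n m u F G v : on_traces m u ->
  (forall u', on_traces (m + n) u' ->
    has_oint (gam (m + n)%N) (fun x => F (upd u' (m + n)%N x)) (G u')) ->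
  has_iter n m u G v -> has_iter n.+1 m u F v.
Proof.
elim: n m u v => [|n IH] m u v tu hF.
  move=> /= <-; exists (fun x => F (upd u m x)), [::]; split => //.
  by have := hF u; rewrite addn0; apply.
move=> [G1 [N [hG1 hN]]]; exists G1, N; split => // x tx xN.
apply: IH (hN x tx xN).
  move=> i; rewrite ltnS leq_eqVlt => /orP[/eqP->|im]; first by rewrite updE.
  by rewrite upd_lt //; exact: tu.
by move=> u'; rewrite addSnnS; exact: hF.
Qed.

(** At each level the actual inner integral agrees with the known function [G] off a finite set, so
    it inherits boundedness and measurability from [G]; no regularity in the outer variables has to
    be proved for it. *)
Lemma has_iter_iter_oint n m u F v (gam' : 'I_n -> R -> C) (F' : ('I_n -> C) -> C) :
  (m + n <= K)%N -> (forall i : 'I_n, gam' i = gam (m + i)%N) ->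
  (forall e, (forall j, (j < m)%N -> e j = u j) -> F e = F' (fun i : 'I_n => e (m + i)%N)) ->
  has_iter n m u F v -> iter_oint gam' F' = v.
Proof.
elim: n m u v gam' F' => [|n IH] m u v gam' F' mK hg hF /=.
  by move=> <-; rewrite (hF u) //; congr F'; apply/funext => -[].
move=> [G [N [hG hN]]].
have mK' : (m < K)%N by apply: leq_trans mK; rewrite addnS ltnS leq_addr.
have [sg _ ig] := cg mK'.
rewrite hg addn0.
suff [_ _ ->] : has_oint (gam m) (fun x => iter_oint (fun i => gam' (lift ord0 i))
    (fun v => F' (ucons x v))) v by [].
apply: (has_oint_eq_off (N := N)) hG => // x tx xN; apply/esym.
apply: IH (hN x tx xN).
- by rewrite addSnnS.
- by move=> i; rewrite hg /= addSnnS.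
- move=> e he; rewrite hF; last first.
    by move=> j jm; rewrite (he j (ltnW jm)) upd_lt.
  congr F'; apply/funext => i; rewrite /ucons.
  case: unliftP => [j ->|->]; first by rewrite /= addSnnS.
  by rewrite addn0 he // updE.
Qed.

Variable q : C.
Hypothesis q0 : q != 0.
Let In i := curve_interior (gam i).
Let Out i := curve_exterior (gam i).
Hypothesis hI : forall i, (i < K)%N -> forall p, In i p ->
  ~ trace (gam i) p /\ winding_number (gam i) p = 1.
Hypothesis hO : forall i, (i < K)%N -> forall p, Out i p ->
  ~ trace (gam i) p /\ winding_number (gam i) p = 0.
Hypothesis nestI : forall i j, (i < j < K)%N -> forall z, In j z -> In i (q * z).
Hypothesis nestO : forall i j, (i < j < K)%N -> forall z, trace (gam i) z -> Out j (z / q).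

Definition pair_prod n (E : rel nat) (c d : C) u : C :=
  \prod_(a < n) \prod_(b < n | (a < b)%N && E a b) kernel q c d (u a) (u b).

Definition vars_prod n (f : nat -> C -> C) u : C := \prod_(i < n) f i (u i).

Lemma vars_prod_upd n f u x :
  vars_prod n.+1 f (upd u n x) = vars_prod n f u * f n x.
Proof.
rewrite /vars_prod big_ord_recr /= updE; congr (_ * _).
by apply: eq_bigr => i _; rewrite upd_lt.
Qed.

Lemma pair_prod_upd n E c d u x : pair_prod n.+1 E c d (upd u n x) =
  pair_prod n E c d u * \prod_(a < n | E a n) kernel q c d (u a) x.
Proof.
rewrite /pair_prod big_ord_recr /= [X in _ * X]big_pred0 ?mulr1; last first.
  by move=> b; rewrite ltnNge -ltnS ltn_ord.
rewrite [X in _ * X]big_mkcond /= -big_split /=; apply: eq_bigr => a _.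
rewrite big_mkcond big_ord_recr /= -big_mkcond /= ltn_ord /= updE.
rewrite upd_lt //; congr (_ * _).
by apply: eq_bigr => b _; rewrite !upd_lt.
Qed.

Lemma prod_filter_iota n (P : pred nat) (F : nat -> C) :
  \prod_(a <- [seq a <- iota 0 n | P a]) F a = \prod_(a < n | P a) F a.
Proof. by rewrite big_filter -[X in iota 0 X]subn0 -/(index_iota 0 n) big_mkord. Qed.

Lemma ratfun_split i f : ratfun (fun p => In i p \/ Out i p) f ->
  exists f1 (ins : seq C), [/\ ratfun (Out i) f1, forall p, p \in ins -> In i p &
    forall v, f v = f1 v / \prod_(p <- ins) (v - p)].
Proof.
move=> [N [ps [hps fE]]].
pose ins := [seq p <- ps | `[< In i p >]]; pose outs := [seq p <- ps | ~~ `[< In i p >]].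
exists (fun v => N.[v] / \prod_(p <- outs) (v - p)), ins; split.
- exists N, outs; split => // p; rewrite mem_filter => /andP[/asboolPn nI /hps].
  by case.
- by move=> p; rewrite mem_filter => /andP[/asboolP].
move=> v; rewrite fE -mulrA -invfM !big_filter; congr (_ / _).
by rewrite [LHS](bigID (fun p => `[< In i p >])) /= mulrC.
Qed.

Definition vanishing_factor n (E : rel nat) (f : nat -> C -> C) j :=
  (ratfun_decay (In j) (f j) /\ forall a, (a < j)%N -> ~~ E a j) \/
  (ratfun (Out j) (f j) /\ forall b, (j < b < n)%N -> ~~ E j b).

(** The factors of [G] are absorbed into [f], which is why the induction hypothesis ranges over all
    [f]. If variable [j] receives a factor, it is coupled to variable [n], which excludes the second
    alternative; in the first one, a decaying function times a proper one with inner poles still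
    decays. *)
Lemma sepsum_vanish n (E : rel nat) c d j G u0 : (n < K)%N -> (j < n)%N ->
  (forall f, (forall i, (i < n)%N -> ratfun (fun p => In i p \/ Out i p) (f i)) ->
     vanishing_factor n.+1 E f j ->
     has_iter n 0 u0 (fun u => vars_prod n f u * pair_prod n E c d u) 0) ->
  sepsum (fun a => (a < n)%N /\ E a n) In G ->
  forall f, (forall i, (i < n)%N -> ratfun (fun p => In i p \/ Out i p) (f i)) ->
     vanishing_factor n.+1 E f j ->
  has_iter n 0 u0 (fun u => vars_prod n f u * pair_prod n E c d u * G u) 0.
Proof.
move=> nK jn IH; elim=> {G} [x|G G' _ IHG _ IHG'|a r G [an Ean] rr _ IHG] f hf vf.
- under eq_fun do rewrite mulrC; rewrite -(mulr0 x).
  by apply: has_iterZ; [exact: ltnW|exact: IH].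
- under eq_fun do rewrite mulrDr; rewrite -(addr0 0).
  by apply: has_iterD; [exact: ltnW|exact: IHG|exact: IHG'].
pose f' i v := if i == a then f i v * r v else f i v.
have f'a : f' a = (fun v => f a v * r v) by apply/funext => v; rewrite /f' eqxx.
have f'n i : i != a -> f' i = f i by move=> /negPf ia; apply/funext => v; rewrite /f' ia.
have -> : (fun u => vars_prod n f u * pair_prod n E c d u * (r (u a) * G u)) =
          (fun u => vars_prod n f' u * pair_prod n E c d u * G u).
  apply/funext => u.
  suff -> : vars_prod n f' u = vars_prod n f u * r (u a) by ring.
  rewrite /vars_prod (bigD1 (Ordinal an)) //= [in RHS](bigD1 (Ordinal an)) //= f'a.
  rewrite mulrAC; congr (_ * _ * _); apply: eq_bigr => i ia.
  by rewrite f'n //; apply: contra ia => /eqP ia; apply/eqP/val_inj.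
apply: IHG.
  move=> i iltn; have [->|ia] := eqVneq i a; last by rewrite f'n //; exact: hf.
  rewrite f'a; apply: ratfunM; first exact: hf.
  by apply: ratfun_sub (ratfun_properW rr) => p; left.
have [ja|ja] := eqVneq j a; last by rewrite /vanishing_factor f'n.
case: vf => -[rf hE]; last first.
  by have := hE n; rewrite ja an ltnSn => /(_ isT); rewrite Ean.
left; split => //; rewrite ja f'a; rewrite ja in rf.
exact: ratfun_decayM.
Qed.

(** If [j] is the innermost variable its own integral is 0: either it has no kernel and decays with
    all poles inside, or all its poles, those of the kernels included, lie outside. Otherwise the
    innermost variable is integrated out, and the result keeps the form of the statement. *)
Lemma has_iter_vanish n (E : rel nat) c d j u0 f : (n <= K)%N -> (j < n)%N ->
  (forall i, (i < n)%N -> ratfun (fun p => In i p \/ Out i p) (f i)) ->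
  vanishing_factor n E f j ->
  has_iter n 0 u0 (fun u => vars_prod n f u * pair_prod n E c d u) 0.
Proof.
elim: n f => [//|n IH] f nK jn hf vf.
have [sg _ ig] := cg nK.
have split_last u x : vars_prod n.+1 f (upd u n x) * pair_prod n.+1 E c d (upd u n x) =
    vars_prod n f u * pair_prod n E c d u *
    (f n x * \prod_(a < n | E a n) kernel q c d (u a) x).
  by rewrite vars_prod_upd pair_prod_upd; ring.
move: jn; rewrite ltnS leq_eqVlt => /orP[/eqP jn|jn].
  apply: (has_iter_last (G := fun=> 0)) (has_iter0 _ _) => //; last exact: ltnW.
  move=> u tu; rewrite add0n in tu *; under eq_fun do rewrite split_last.
  rewrite -(mulr0 (vars_prod n f u * pair_prod n E c d u)); apply: has_ointZ => //.
  case: vf => -[rf hE].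
    rewrite jn in rf hE; have := oint_inside (cg nK) (hI nK) rf.
    apply: has_oint_eq => // z _; rewrite big_pred0 ?mulr1 // => a.
    exact/negbTE/hE.
  apply: (oint_outside (cg nK) (hO nK)); rewrite jn in rf; apply: ratfunM => //.
  under eq_fun do rewrite -(prod_filter_iota n (E^~ n) (fun a => kernel q c d (u a) _)).
  apply: ratfun_prod => a; rewrite mem_filter mem_iota add0n /= => /andP[_ an].
  apply: ratfun_kernel => //; apply: nestO (tu a an); by rewrite an.
have [f1 [ins [rf1 hins fE]]] := ratfun_split (hf n (ltnSn n)).
pose A := [seq (a, (c, d)) | a <- iota 0 n & E a n].
have memA x : x \in A -> (x.1 < n)%N /\ E x.1 n.
  move=> /mapP[a]; rewrite mem_filter mem_iota add0n /= => /andP[? ?] ->.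
  by split.
have [x p xA Ip|u x tu xA|G sG hG] := @oint_kernels R (gam n) (In n) (Out n) (cg nK)
   (hI nK) (hO nK) q q0 In (on_traces n) A (fun a => (a < n)%N /\ E a n) ins f1 rf1 hins.
- by have [xn Ex] := memA _ xA; split => //; apply: nestI Ip; rewrite xn.
- by have [xn Ex] := memA _ xA; apply: nestO (tu _ xn); rewrite xn.
apply: (has_iter_last (G := fun u => vars_prod n f u * pair_prod n E c d u * G u)) => //.
  move=> u tu; rewrite add0n in tu *; under eq_fun do rewrite split_last.
  apply: has_ointZ => //; apply: has_oint_eq (hG u tu) => // z _.
  by rewrite fE big_map (prod_filter_iota n (E^~ n) (fun a => kernel q c d (u a) z)).
apply: (sepsum_vanish (j := j)) => //.
- move=> f' hf' vf'; apply: IH => //; first exact: ltnW.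
  case: vf' => -[rf hE]; [by left|right; split => // b /andP[jb bn]].
  by apply: hE; rewrite jb ltnW.
- by move=> i iltn; apply: hf; exact: ltnW.
Qed.

Variables (lam : nat -> nat) (pt : nat -> C) (w : nat -> C -> C).
Hypothesis hw : forall i j, (i < K)%N -> ratfun (Out i) (w j).

Definition incr_at (e : nat -> nat) j i := (e i + (i == j))%N.

(** [e l] counts the variables of block [l] already integrated out, so the pole of that block now
    sits at [q ^+ e l * pt l]; each step contributes the value of [w] there. *)
Fixpoint diag_value n (e : nat -> nat) : C :=
  if n is n'.+1 then
    w (lam n') (q ^+ e (lam n') * pt (lam n')) * diag_value n' (incr_at e (lam n'))
  else 1.

Definition diag_factor (e : nat -> nat) i v := w (lam i) v / (v - q ^+ e (lam i) * pt (lam i)).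

(* The residue at the only inner pole [p] of the last variable multiplies the
   variables of the same block by [(u - p) / (u - q p)], which moves their pole
   from [p] to [q p]. *)
Lemma has_iter_diag n e u0 : (n <= K)%N ->
  (forall i, (i < n)%N -> In i (q ^+ e (lam i) * pt (lam i))) ->
  has_iter n 0 u0 (fun u => vars_prod n (diag_factor e) u *
    pair_prod n (fun a b => lam a == lam b) 1 (-1) u) (diag_value n e).
Proof.
elim: n e => [|n IH] e nK he.
  by rewrite /= /vars_prod /pair_prod !big_ord0 mulr1.
have [sg _ ig] := cg nK.
set l := lam n; set p := q ^+ e l * pt l.
have Ip : In n p by exact: he.
have nestp i : (i < n)%N -> In i (q * p) by move=> iln; apply: nestI Ip; rewrite iln.
have e'E i : lam i = l -> q ^+ incr_at e l (lam i) * pt (lam i) = q * p.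
  by move=> ->; rewrite /incr_at eqxx addn1 exprS mulrA.
have e'n i : lam i != l -> incr_at e l (lam i) = e (lam i).
  by move=> /negPf h; rewrite /incr_at h addn0.
apply: (has_iter_last (G := fun u => w l p * (vars_prod n (diag_factor (incr_at e l)) u *
    pair_prod n (fun a b => lam a == lam b) 1 (-1) u))) => //; last first.
  apply: has_iterZ; first exact: ltnW.
  apply: IH; first exact: ltnW.
  move=> i iln; have [li|li] := eqVneq (lam i) l; first by rewrite e'E //; exact: nestp.
  by rewrite e'n //; apply: he; exact: ltnW.
move=> u tu; rewrite add0n in tu *.
pose ker v := \prod_(a < n | lam a == l) kernel q 1 (-1) (u a) v.
have rker : ratfun (Out n) ker.
  rewrite /ker; under eq_fun do
    rewrite -(prod_filter_iota n (fun a => lam a == l) (fun a => kernel q 1 (-1) (u a) _)).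
  apply: ratfun_prod => a; rewrite mem_filter mem_iota add0n /= => /andP[_ an].
  by apply: ratfun_kernel => //; apply: nestO (tu a an); rewrite an.
have := oint_simple_pole (cg nK) (hI nK) (hO nK) (ratfunM (hw l nK) rker) Ip.
move=> /(has_ointZ (vars_prod n (diag_factor e) u *
    pair_prod n (fun a b => lam a == lam b) 1 (-1) u) sg).
have -> : w l p * (vars_prod n (diag_factor (incr_at e l)) u *
    pair_prod n (fun a b => lam a == lam b) 1 (-1) u) =
  vars_prod n (diag_factor e) u * pair_prod n (fun a b => lam a == lam b) 1 (-1) u *
    (w l p * ker p).
  suff -> : vars_prod n (diag_factor (incr_at e l)) u = vars_prod n (diag_factor e) u * ker p.
    by ring.
  rewrite /vars_prod /ker [X in _ * X]big_mkcond -big_split /=; apply: eq_bigr => i _.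
  rewrite /diag_factor; case: eqP => [li|/eqP li]; last by rewrite e'n // mulr1.
  rewrite e'E // li -/p /kernel mul1r mulN1r.
  have n1 : u i - p != 0.
    have Iip : In i p by have := he i (ltnW (ltn_ord i)); rewrite li.
    have [np _] := hI (ltn_trans (ltn_ord i) nK) Iip.
    exact: trace_sub_neq0 np (tu i (ltn_ord i)).
  by rewrite [RHS]mulrA divfK.
apply: has_oint_eq => // z _; rewrite vars_prod_upd pair_prod_upd /diag_factor -/l -/p /ker.
by ring.
Qed.

End IteratedIntegrals.

(** * The winding number is locally constant and vanishes on the exterior *)

Section Winding.
Variable R : realType.
Local Notation C := R[i].
Local Notation Re := complex.Re.
Local Notation Im := complex.Im.
Implicit Types (g : R -> C) (x y z : C).

(* Unlike [`|z|], takes its values in [R]. *)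
Definition norm1 z : R := `|Re z| + `|Im z|.

Lemma norm1_ge0 z : 0 <= norm1 z. Proof. exact: addr_ge0. Qed.

Lemma norm1_eq0 z : norm1 z = 0 -> z = 0.
Proof.
move/eqP; rewrite paddr_eq0 // !normr_eq0; case: z => a b /= /andP[/eqP-> /eqP->].
by [].
Qed.

Lemma norm1N z : norm1 (- z) = norm1 z.
Proof. by rewrite /norm1 ReN ImN !normrN. Qed.

Lemma norm1D x y : norm1 (x + y) <= norm1 x + norm1 y.
Proof.
rewrite /norm1 ReD ImD; have := ler_normD (Re x) (Re y); have := ler_normD (Im x) (Im y).
lra.
Qed.

Lemma norm1M x y : norm1 (x * y) <= norm1 x * norm1 y.
Proof.
rewrite /norm1 ReM ImM.
have := ler_normB (Re x * Re y) (Im x * Im y); have := ler_normD (Re x * Im y) (Im x * Re y).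
rewrite !normrM; lra.
Qed.

(** The 2 comes from comparing norms: [norm1 z ^+ 2] is at most twice the squared modulus. *)
Lemma norm1V z (d : R) : 0 < d -> d <= norm1 z -> norm1 z^-1 <= 2 / d.
Proof.
move=> d0 dz; have z0 : z != 0.
  apply: contraTneq dz => ->; rewrite /norm1 /= normr0 addr0 -ltNge.
  by [].
rewrite /norm1 ReV ImV normrN !normrM -mulrDl -/(norm1 z).
set S := Re z ^+ 2 + Im z ^+ 2.
have S0 : 0 < S by rewrite lt_neqAle eq_sym sqrnorm_neq0 // addr_ge0 // sqr_ge0.
rewrite (ger0_norm (ltW _)) ?invr_gt0 // ler_pdivrMr // mulrAC ler_pdivlMr //.
have h : norm1 z ^+ 2 <= 2 * S.
  rewrite /S -(real_normK (num_real (Re z))) -(real_normK (num_real (Im z))) /norm1.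
  have := sqr_ge0 (`|Re z| - `|Im z|); rewrite !expr2; nra.
apply: le_trans h; rewrite expr2; apply: ler_wpM2l => //; exact: norm1_ge0.
Qed.

Lemma dist_trace g z : smooth_curve g -> ~ trace g z ->
  exists2 d : R, 0 < d & forall w, trace g w -> d <= norm1 (w - z).
Proof.
move=> sg nz; pose k t := Re (g t - z) ^+ 2 + Im (g t - z) ^+ 2.
have ck : cont01 k.
  have [a b] : contour_cont g (fun u => u - z).
    by apply: contour_contD; [exact: contour_cont_id|exact: contour_cont_cst].
  rewrite /k; under eq_fun do rewrite !expr2.
  by apply: cont01D; exact: cont01M.
have [c c01 hc] := EVT_min ler01 ck.
have k0 : 0 < k c.
  rewrite lt_neqAle eq_sym addr_ge0 ?sqr_ge0 // andbT; apply: sqrnorm_neq0.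
  by apply: (trace_sub_neq0 nz); exists c.
exists (Num.sqrt (k c)); first by rewrite sqrtr_gt0.
move=> _ [t t01 <-]; have h1 := hc t t01.
rewrite -[norm1 _]ger0_norm ?norm1_ge0 // -sqrtr_sqr ler_wsqrtr //.
apply: (le_trans h1); rewrite /k /norm1 sqrrD.
rewrite !real_normK ?num_real // addrAC lerDl mulrn_wge0 //; exact: mulr_ge0.
Qed.

Lemma oint_norm1_bound g : smooth_curve g -> exists2 K : R, 0 <= K &
  forall f v (M : R), has_oint g f v -> (forall z, trace g z -> norm1 (f z) <= M) ->
  norm1 v <= K * M.
Proof.
move=> sg; have [K K0 hK] := oint_bound sg.
pose c := (2 * (@pi R)%:C * 'i%C)^-1 : C.
exists (norm1 c * (K + K)).
  by apply: mulr_ge0; [exact: norm1_ge0|exact: addr_ge0].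
move=> f v M hf hM; have [|h1 h2] := hK f v M hf.
  move=> z /hM; rewrite /norm1; have := normr_ge0 (Re (f z)); have := normr_ge0 (Im (f z)).
  by split; lra.
case: hf => _ _ <-; apply: (le_trans (norm1M _ _)); rewrite -/c -mulrA.
apply: ler_wpM2l; first exact: norm1_ge0.
by rewrite mulrDl; exact: lerD.
Qed.

(* The second divided difference kills the linear term since 1/(u-z)^2 has a
   primitive; hence the winding number has zero derivative. *)
Lemma winding_quadratic g (d : R) : closed_curve g -> 0 < d -> exists2 L : R, 0 <= L &
  forall z z', (forall w, trace g w -> d <= norm1 (w - z)) ->
               (forall w, trace g w -> d <= norm1 (w - z')) ->
  norm1 (winding_number g z' - winding_number g z) <= L * norm1 (z' - z) ^+ 2.
Proof.
move=> cg d0; have [sg _ ig] := cg; have [K K0 hK] := oint_norm1_bound sg.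
exists (K * (2 / d) ^+ 3).
  by apply: mulr_ge0 => //; apply: exprn_ge0; apply: divr_ge0 => //; exact: ltW.
move=> z z' dz dz'.
have ntz x : (forall w, trace g w -> d <= norm1 (w - x)) -> ~ trace g x.
  by move=> dx /dx; rewrite subrr /norm1 /= normr0 addr0 leNgt d0.
have nz := ntz _ dz; have nz' := ntz _ dz'.
have h1 := oint_winding cg nz; have h2 := oint_winding cg nz'; have h3 := oint_Vpow 0 cg nz.
have H := has_ointD sg h2 (has_ointD sg (has_ointZ (-1) sg h1) (has_ointZ (z - z') sg h3)).
rewrite mulr0 addr0 mulN1r in H.
have H' : has_oint g (fun u => (z' - z) * (z' - z) * ((u - z)^-1 * ((u - z)^-1 * (u - z')^-1)))
    (winding_number g z' - winding_number g z).
  apply: has_oint_eq H => // u tu.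
  have n1 := trace_sub_neq0 nz tu; have n2 := trace_sub_neq0 nz' tu.
  by field; rewrite n1 n2.
rewrite -mulrA; apply: (hK _ _ _ H') => u tu.
have v1 := norm1V d0 (dz u tu); have v2 := norm1V d0 (dz' u tu).
apply: (le_trans (norm1M _ _)); rewrite mulrC.
apply: ler_pM; [exact: norm1_ge0|exact: norm1_ge0| |].
  apply: (le_trans (norm1M _ _)); rewrite exprS expr2.
  apply: ler_pM; [exact: norm1_ge0|exact: norm1_ge0|exact: v1|].
  apply: (le_trans (norm1M _ _)).
  by apply: ler_pM => //; exact: norm1_ge0.
by rewrite expr2; exact: norm1M.
Qed.

Lemma archimedean_eq0 (a b : R) : 0 <= a -> (forall n, n.+1%:R * a <= b) -> a = 0.
Proof.
move=> a0 h; apply/eqP; rewrite eq_le a0 andbT leNgt; apply/negP => apos.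
have b0 : 0 <= b by apply: le_trans (h 0%N); rewrite mulr_ge0.
have := archi_boundP (divr_ge0 b0 a0); rewrite ltr_pdivrMr // => hb.
have := h (Num.bound (b / a)); rewrite leNgt; case/negP.
by apply: (lt_trans hb); rewrite ltr_pM2r // ltr_nat.
Qed.

(** Cut the segment from [z] to [z'] into [n + 1] equal steps, all at distance at least [d / 2] from
    the curve. Each step changes the winding number by [O((n + 1)^-2)], so the total change is
    [O((n + 1)^-1)] for every [n]. *)
Lemma winding_locally_const g z : closed_curve g -> ~ trace g z -> exists2 e : R, 0 < e &
  forall z', norm1 (z' - z) < e -> ~ trace g z' /\ winding_number g z' = winding_number g z.
Proof.
move=> cg nz; have [sg _ _] := cg; have [d d0 hd] := dist_trace sg nz.
have d2 : 0 < d / 2 by rewrite divr_gt0.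
have [L L0 hL] := winding_quadratic cg d2.
exists (d / 2) => // z' hz'.
have far x : norm1 (x - z) < d / 2 -> forall w, trace g w -> d / 2 <= norm1 (w - x).
  move=> hx w tw; have := hd w tw; have := norm1D (w - x) (x - z).
  rewrite addrA subrK => *; lra.
split.
  by move=> /(far _ hz'); rewrite subrr /norm1 /= normr0 addr0 leNgt d2.
apply/eqP; rewrite -subr_eq0; apply/eqP; apply: norm1_eq0.
apply: (@archimedean_eq0 _ (L * norm1 (z' - z) ^+ 2)); first exact: norm1_ge0.
move=> n; pose s (j : nat) : C := z + (j%:R / n.+1%:R)%:C * (z' - z).
have n0 : 0 < n.+1%:R :> R by rewrite ltr0n.
have norm1R (a : R) x : norm1 (a%:C * x) = `|a| * norm1 x.
  by rewrite /norm1 ReM ImM /= !mul0r subr0 addr0 !normrM mulrDr.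
have sE (j : nat) : (j <= n.+1)%N -> norm1 (s j - z) < d / 2.
  move=> jn; rewrite /s addrC addKr norm1R ger0_norm ?divr_ge0 //.
  apply: le_lt_trans hz'; rewrite ler_piMl ?norm1_ge0 // ler_pdivrMr // mul1r ler_nat.
  exact: jn.
have step j : (j < n.+1)%N -> norm1 (winding_number g (s j.+1) - winding_number g (s j)) <=
    L * (norm1 (z' - z) / n.+1%:R) ^+ 2.
  move=> jn.
  have := hL (s j) (s j.+1) (far _ (sE _ (ltnW jn))) (far _ (sE _ jn)).
  suff -> : s j.+1 - s j = (n.+1%:R^-1)%:C * (z' - z).
    by rewrite norm1R ger0_norm ?invr_ge0 // [_^-1 * _]mulrC.
  rewrite /s opprD addrACA subrr add0r -mulrBl -rmorphB /= -mulrBl -natr1 addrC addKr mul1r.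
  by [].
have tot j : (j <= n.+1)%N -> norm1 (winding_number g (s j) - winding_number g z) <=
    j%:R * (L * (norm1 (z' - z) / n.+1%:R) ^+ 2).
  elim: j => [|j IH] jn.
    by rewrite /s !mul0r addr0 subrr /norm1 /= normr0 addr0.
  have := norm1D (winding_number g (s j.+1) - winding_number g (s j))
                 (winding_number g (s j) - winding_number g z).
  rewrite addrA subrK -natr1 mulrDl mul1r => h.
  by apply: (le_trans h); rewrite addrC; apply: lerD; [exact/IH/ltnW|exact: step].
have := tot n.+1 (leqnn _).
have -> : s n.+1 = z' by rewrite /s divff ?gt_eqF // mul1r addrC subrK.
move=> h; have := ler_wpM2l (ltW n0) h.
suff -> : n.+1%:R * (n.+1%:R * (L * (norm1 (z' - z) / n.+1%:R) ^+ 2)) =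
          L * norm1 (z' - z) ^+ 2 by [].
by field; rewrite gt_eqF // -?natr1 ?addrC.
Qed.

Local Notation toC p := (p.1 +i* p.2 : C).
Local Notation off_trace g := [set p : R * R | ~ trace g (toC p)].

(** By local constancy, the points of [B] sharing the winding number of [p] form a nonempty subset
    that is both relatively open and relatively closed. *)
Lemma winding_connected g (B : set (R * R)) p p' : closed_curve g -> connected B ->
  B `<=` off_trace g -> B p -> B p' ->
  winding_number g (toC p) = winding_number g (toC p').
Proof.
move=> cg cB Bo Bp Bp'.
have opn (Q : C -> Prop) : open [set x : R * R | ~ trace g (toC x) /\ Q (winding_number g (toC x))].
  rewrite openE => x [nx Qx]; have [e e0 he] := winding_locally_const cg nx.
  apply/nbhs_ballP; exists (e / 2) => /=; first by rewrite divr_gt0.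
  move=> y [/= y1 y2]; have [|ny wy] := he (toC y); last by split => //; rewrite wy.
  move: y1 y2; rewrite /ball /= /norm1 /= => y1 y2.
  by rewrite [X in X + _]distrC [X in _ + X]distrC; lra.
pose S := B `&` [set x | ~ trace g (toC x) /\ winding_number g (toC x) = winding_number g (toC p)].
have SB : S = B.
  apply: cB.
  - by exists p; split => //; split => //; exact: Bo.
  - by eexists; first exact: (opn (fun w => w = winding_number g (toC p))).
  - exists (~` [set x | ~ trace g (toC x) /\ winding_number g (toC x) <> winding_number g (toC p)]).
      by apply: open_closedC; exact: (opn (fun w => w <> winding_number g (toC p))).
    apply/seteqP; split=> x [Bx] /=; first by move=> [_ wx]; split => // -[].
    move=> h; split => //; split; first exact: Bo.
    by apply: contrapT => wx; apply: h; split => //; exact: Bo.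
have : S p' by rewrite SB.
by move=> [_ [_ ->]].
Qed.

Lemma unboundedP (A : set (R * R)) : ~ bounded_set A -> forall M : R, exists2 p, A p & M < `|p|.
Proof.
move=> nb M; apply: contrapT => h; apply: nb; exists M; split; first exact: num_real.
move=> N MN p Ap; apply: le_trans (ltW MN); rewrite leNgt; apply/negP => Mp.
by apply: h; exists p.
Qed.

Lemma trace_norm1_bound g : smooth_curve g -> exists M : R, forall z, trace g z -> norm1 z <= M.
Proof.
move=> [[c1 _] [c2 _]].
have [_ [A hA]] := bdd_meas_continuous c1; have [_ [B hB]] := bdd_meas_continuous c2.
exists (A + B) => _ [t t01 <-]; move: t01; rewrite /= in_itv /= => t01.
by apply: lerD; [exact: hA|exact: hB].
Qed.

Lemma norm_le_norm1 (p : R * R) : `|p| <= norm1 (toC p).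
Proof.
by rewrite /norm1 /= prod_normE ge_max lerDl lerDr !normr_ge0.
Qed.

Lemma winding_exterior g z : closed_curve g -> curve_exterior g z -> winding_number g z = 0.
Proof.
move=> cg [nz nI]; have [sg _ _] := cg.
have zE : toC (Re z, Im z) = z by case: (z).
set A := connected_component (off_trace g) (Re z, Im z).
have nb : ~ bounded_set A by move=> bA; apply: nI.
have [K K0 hK] := oint_norm1_bound sg; have [M hM] := trace_norm1_bound sg.
apply: norm1_eq0; apply: (@archimedean_eq0 _ (2 * K)); first exact: norm1_ge0.
(* [M] bounds the curve, so this [p] is at distance at least [n + 1] from it, and the integral of
   [1/(u - p)] is [O(1/(n + 1))]. *)
move=> n; have [p Ap np] := unboundedP nb (M + n.+1%:R).
have Asub : A `<=` off_trace g by exact: connected_component_sub.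
have Az : A (Re z, Im z) by apply: connected_component_refl; rewrite /= zE.
have cA : connected A by exact: component_connected.
have := winding_connected cg cA Asub Az Ap; rewrite zE => ->.
have n0 : 0 < n.+1%:R :> R by rewrite ltr0n.
have ntp := Asub _ Ap.
have : norm1 (winding_number g (toC p)) <= K * (2 / n.+1%:R).
  apply: (hK _ _ _ (oint_winding cg ntp)) => u tu; apply: norm1V => //.
  have h1 := norm_le_norm1 p; have h2 := hM u tu.
  have := norm1D (toC p - u) u; rewrite subrK -(norm1N (_ - _)) opprB => h3; lra.
move=> h; have := ler_wpM2l (ltW n0) h.
suff -> : n.+1%:R * (K * (2 / n.+1%:R)) = 2 * K by [].
by field; rewrite gt_eqF // -?natr1 ?addrC.
Qed.

End Winding.

(** * Nesting of interiors and exteriors under scaling by [q] *)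

Section Nesting.
Variable R : realType.
Local Notation C := R[i].
Local Notation Re := complex.Re.
Local Notation Im := complex.Im.
Local Notation toC p := (p.1 +i* p.2 : C).
Local Notation toR2 z := ((Re z, Im z) : R * R).
Local Notation off_trace g := [set p : R * R | ~ trace g (toC p)].
Implicit Types (g : R -> C) (z : C).

Lemma toR2K z : toC (toR2 z) = z. Proof. by case: z. Qed.

Lemma bounded_setP (A : set (R * R)) : bounded_set A -> exists M : R, forall p, A p -> `|p| <= M.
Proof. by move=> [M [_ hM]]; exists (M + 1) => p Ap; apply: (hM (M + 1)) => //; rewrite ltrDl. Qed.

Lemma connected_bounded (A B : set (R * R)) p : bounded_set (connected_component A p) ->
  connected B -> B p -> B `<=` A -> exists M : R, forall x, B x -> `|x| <= M.
Proof.
move=> /bounded_setP[M hM] cB Bp BA; exists M => x Bx; apply: hM.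
exact: (connected_component_max Bp BA cB).
Qed.

Lemma pair_continuous (T : topologicalType) (a b : T -> R) : continuous a -> continuous b ->
  continuous (fun t => (a t, b t) : R * R).
Proof. by move=> ca cb t; exact: cvg_pair (ca t) (cb t). Qed.

Definition scale2 (c : R) (p : R * R) : R * R := (c * p.1, c * p.2).

Lemma toC_scale2 c p : toC (scale2 c p) = c%:C * toC p.
Proof. by apply: complexP; rewrite ?ReM ?ImM /= !mul0r ?subr0 ?addr0. Qed.

Lemma norm_scale2 c p : `|scale2 c p| = `|c| * `|p|.
Proof. by rewrite !prod_normE /= !normrM maxr_pMr. Qed.

Lemma connected_scale2 c (A : set (R * R)) : connected A -> connected (scale2 c @` A).
Proof.
move=> cA; apply: connected_continuous_connected => //; apply: continuous_subspaceT.
by apply: pair_continuous => p; apply: cvgM;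
  [exact: cvg_cst|exact: cvg_fst|exact: cvg_cst|exact: cvg_snd].
Qed.

Lemma connected_ray (a : R) (p : R * R) : connected ((fun t : R => scale2 t p) @` `[a, +oo[).
Proof.
apply: connected_continuous_connected.
  by apply/connected_intervalP; exact: interval_is_interval.
apply: continuous_subspaceT; apply: pair_continuous => t; apply: cvgM;
  [exact: cvg_id|exact: cvg_cst|exact: cvg_id|exact: cvg_cst].
Qed.

Lemma ray_unbounded (a : R) (p : R * R) (M : R) : p != 0 ->
  ~ forall x, ((fun t : R => scale2 t p) @` `[a, +oo[) x -> `|x| <= M.
Proof.
move=> p0 h; have np : 0 < `|p| by rewrite normr_gt0.
pose t := `|a| + (`|M| + 1) / `|p|.
have t0 : 0 <= t by rewrite addr_ge0 // divr_ge0 // addr_ge0.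
have := h (scale2 t p); rewrite norm_scale2 ger0_norm // => /(_ _).
have /[swap]/[apply] : ((fun t : R => scale2 t p) @` `[a, +oo[) (scale2 t p).
  exists t => //=; rewrite in_itv /= andbT; apply: (le_trans (ler_norm a)).
  by rewrite lerDl divr_ge0 // addr_ge0.
rewrite mulrDl divfK ?gt_eqF // leNgt; case/negP.
have := ler_norm M; have : 0 <= `|a| * `|p| by rewrite mulr_ge0.
lra.
Qed.

Lemma connected_trace g : smooth_curve g -> connected ((fun t => toR2 (g t)) @` `[0, 1]).
Proof.
move=> [[c1 _] [c2 _]]; apply: connected_continuous_connected.
  exact: segment_connected.
by move=> t; exact: cvg_pair (c1 t) (c2 t).
Qed.

Lemma curve_interior_exterior g z : curve_interior g z -> ~ curve_exterior g z.
Proof. by move=> Iz [_]. Qed.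

Section TwoCurves.
Variables (A B : R -> C) (q : R).
Hypotheses (cA : closed_curve A) (cB : closed_curve B) (q0 : 0 < q).
Hypothesis qB : forall v, trace B v -> curve_interior A (q%:C * v).

Let qC0 : q%:C != 0 :> C. Proof. by apply/eqP => -[] /eqP; rewrite gt_eqF. Qed.

Lemma scaled_off_trace u : trace A u -> ~ trace B (u / q%:C).
Proof. by move=> tu /qB; rewrite mulrC divfK // => -[]. Qed.

Lemma trace_max : exists2 v, trace B v & v != 0 /\
  forall w, trace B w -> Re w ^+ 2 + Im w ^+ 2 <= Re v ^+ 2 + Im v ^+ 2.
Proof.
have [sB _ iB] := cB; pose k t := Re (B t) ^+ 2 + Im (B t) ^+ 2.
have ck : cont01 k.
  have [a b] := contour_cont_id sB; rewrite /k; under eq_fun do rewrite !expr2.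
  by apply: cont01D; exact: cont01M.
have [c c01 hc] := EVT_max ler01 ck.
exists (B c); first by exists c.
have mx w : trace B w -> Re w ^+ 2 + Im w ^+ 2 <= Re (B c) ^+ 2 + Im (B c) ^+ 2.
  by move=> [t t01 <-]; exact: hc.
split => //; apply/eqP => Bc0.
have B0 t : 0 <= t <= 1 -> B t = 0.
  move=> t01; apply/eqP; apply: contraT => /sqrnorm_neq0.
  have tr : trace B (B t) by exists t => //=; rewrite in_itv.
  have := mx _ tr; rewrite Bc0 /= expr0n /= addr0 => h.
  by rewrite eq_le h addr_ge0 ?sqr_ge0.
(* If the farthest point were 0, the curve would be constant, against injectivity at the parameters
   0 and 1/2. *)
have h01 : (0 : R) = 1 / 2.
  apply: iB; rewrite ?in_itv /= ?lexx ?ltr01 //.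
    by apply/andP; split; lra.
  by rewrite !B0 // ?lexx ?ler01 //; apply/andP; split; lra.
by have : (0 : R) < 1 / 2 by [rewrite divr_gt0]; rewrite -h01 ltxx.
Qed.

(* The curve [A / q] is connected and off [B]; it reaches a point of modulus larger
   than all of [B], found on the ray through the farthest point of [B]. *)
Lemma trace_scaled_exterior u : trace A u -> curve_exterior B (u / q%:C).
Proof.
move=> tu; split; first exact: scaled_off_trace.
move=> [_ bC]; have [v tv [v0 vmax]] := trace_max.
have v20 : toR2 v != 0.
  by apply: contraNneq v0 => -[v1 v2]; rewrite -(toR2K v) v1 v2.
have qv20 : scale2 q (toR2 v) != 0.
  by rewrite -normr_gt0 norm_scale2 mulr_gt0 ?normr_gt0 // gt_eqF.
have [nqv bqv] := qB tv.
(* [q v] lies inside [A], so the unbounded ray starting there cannot stay in its component and must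
   cross [A]. *)
have [t0 t01 tA] : exists2 t : R, 1 < t & trace A (t%:C * (q%:C * v)).
  apply: contrapT => nex.
  have hray : ((fun t : R => scale2 t (scale2 q (toR2 v))) @` `[1, +oo[) `<=` off_trace A.
    move=> _ [t t1 <-]; rewrite -[_ _]/(~ trace A (toC (scale2 t (scale2 q (toR2 v))))).
    rewrite !toC_scale2 toR2K.
    move: t1; rewrite /= in_itv /= andbT le_eqVlt => /orP[/eqP<-|t1] tA.
      by apply: nqv; rewrite mul1r in tA.
    by apply: nex; exists t.
  have [|M hM] := connected_bounded bqv (@connected_ray 1 (scale2 q (toR2 v))) _ hray.
    exists 1; first by rewrite /= in_itv /= lexx.
    by rewrite /scale2 ReM ImM /= !mul1r !mul0r subr0 addr0.
  exact: (ray_unbounded qv20 hM).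
have [sA _ _] := cA.
pose T := scale2 q^-1 @` ((fun t => toR2 (A t)) @` `[0, 1]).
pose Y := (fun t : R => scale2 t (toR2 v)) @` `[t0, +oo[.
have memT x : trace A x -> T (toR2 (x / q%:C)).
  move=> [t tt <-]; exists (toR2 (A t)); first by exists t.
  by rewrite -fmorphV /= mulrC /scale2 ReM ImM /= !mul0r subr0 addr0.
have TB : T `<=` off_trace B.
  move=> _ [_ [t tt <-] <-].
  rewrite -[_ _]/(~ trace B (toC (scale2 q^-1 (toR2 (A t))))) toC_scale2 toR2K fmorphV /= mulrC.
  by apply: scaled_off_trace; exists t.
have YB : Y `<=` off_trace B.
  move=> _ [t tt <-]; rewrite -[_ _]/(~ trace B (toC (scale2 t (toR2 v)))).
  rewrite toC_scale2 toR2K => /vmax.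
  move: tt; rewrite /= in_itv /= andbT => tt.
  rewrite ReM ImM /= !mul0r subr0 addr0 !exprMn -mulrDr.
  have S0 : 0 < Re v ^+ 2 + Im v ^+ 2.
    by rewrite lt_neqAle eq_sym sqrnorm_neq0 // addr_ge0 // sqr_ge0.
  rewrite leNgt => /negP; apply; rewrite ltr_pMl // expr2.
  have t1 : 1 < t by exact: lt_le_trans tt.
  by rewrite -(mulr1 1) ltr_pM.
(* The scaled curve [T] and the ray [Y] meet at [t0 v]. Their union is connected, avoids [B] (on [Y]
   because [t0 > 1] lies beyond the farthest point) and is unbounded, which contradicts that the
   component of [u / q] is bounded. *)
have [||x|M hM] := connected_bounded bC (B := T `|` Y).
- apply: connectedU; [|exact/connected_scale2/connected_trace|exact: connected_ray].
  exists (scale2 t0 (toR2 v)); split; last first.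
    by exists t0 => //=; rewrite in_itv /= lexx.
  have := memT _ tA; suff -> : t0%:C * (q%:C * v) / q%:C = t0%:C * v.
    by rewrite /scale2 ReM ImM /= !mul0r subr0 addr0.
  by field.
- by left; exact: memT.
- by case=> [/TB|/YB].
by apply: (@ray_unbounded t0 _ M v20) => x Yx; apply: hM; right.
Qed.

(** Let [X] be the component of [q z] off [A]. If [X] meets [q B], it contains an interior point of
    [A] and is bounded. If not, [X / q] is connected and off [B], hence lies in the bounded
    component of [z]. *)
Lemma scaled_interior z : curve_interior B z -> curve_interior A (q%:C * z).
Proof.
move=> Iz; have nA : ~ trace A (q%:C * z).
  move=> /trace_scaled_exterior; rewrite mulrC mulKf //.
  exact: curve_interior_exterior.
split => //; set X := connected_component _ _.
have Xz : X (toR2 (q%:C * z)) by apply: connected_component_refl; rewrite /= toR2K.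
have [[x [Xx tx]]|nex] := pselect (exists x, X x /\ trace B (toC (scale2 q^-1 x))).
  have [_ bx] := qB tx.
  have E : toR2 (q%:C * toC (scale2 q^-1 x)) = x.
    rewrite toC_scale2 mulrA -rmorphM /= divff ?gt_eqF // !mul1r !mul0r subr0 addr0.
    by case: (x).
  by rewrite E in bx; rewrite /X (same_connected_component Xx).
have [_ bz] := Iz.
have [|||M hM] := connected_bounded bz (B := scale2 q^-1 @` X).
- by apply: connected_scale2; exact: component_connected.
- exists (toR2 (q%:C * z)) => //.
  by rewrite /scale2 ReM ImM /= !mul0r subr0 addr0 !mulKf ?gt_eqF //.
- by move=> _ [x Xx <-] /= tx; apply: nex; exists x.
exists (q * M); split; first exact: num_real.
move=> N MN x Xx; apply: le_trans (ltW MN).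
have := hM (scale2 q^-1 x); rewrite norm_scale2 => /(_ (ex_intro2 _ _ x Xx erefl)).
rewrite gtr0_norm ?invr_gt0 // => h.
by rewrite -(ler_pM2l (x := q^-1)) ?invr_gt0 // mulKf ?gt_eqF.
Qed.
End TwoCurves.
End Nesting.

(** * The Hall-Littlewood symmetrization identity *)

Section Symmetrization.
Variables (F : fieldType) (q : F).

(** Coefficient of [X^n] in the Lagrange interpolation formula at [n + 1] nodes. *)
Lemma lagrange_lead (xs : seq F) (P : {poly F}) n : uniq xs -> size xs = n.+1 ->
  (size P <= n.+1)%N ->
  \sum_(x <- xs) P.[x] / \prod_(y <- xs | y != x) (x - y) = P`_n.
Proof.
move=> uxs sxs sP.
pose B x : {poly F} := \prod_(y <- [seq y <- xs | y != x]) ('X - y%:P).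
have sizeB x : x \in xs -> size (B x) = n.+1.
  move=> xin; rewrite /B size_prod_XsubC size_filter.
  have := count_predC (pred1 x) xs; rewrite sxs count_uniq_mem // xin add1n.
  by move=> [->].
have BE x z : (B x).[z] = \prod_(y <- xs | y != x) (z - y).
  by rewrite /B big_filter horner_prod; apply: eq_bigr => y _; rewrite !hornerE.
have nz x : \prod_(y <- xs | y != x) (x - y) != 0.
  by rewrite prodf_seq_neq0; apply/allP => y _; apply/implyP; rewrite subr_eq0 eq_sym.
pose L := \sum_(x <- xs) (P.[x] / \prod_(y <- xs | y != x) (x - y)) *: B x.
have Lx z : z \in xs -> L.[z] = P.[z].
  move=> zin; rewrite /L horner_sum (bigD1_seq z) //= hornerZ BE divfK // big1 ?addr0 //.
  move=> x xz; rewrite hornerZ BE; apply/eqP; rewrite mulf_eq0; apply/orP; right.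
  by rewrite prodf_seq_eq0; apply/hasP; exists z; rewrite // subrr eqxx eq_sym xz.
have LP : L = P.
  apply/eqP; rewrite -subr_eq0; apply/eqP; apply: (@roots_geq_poly_eq0 _ _ xs) => //.
    by apply/allP => z zin; rewrite /root !hornerE Lx // subrr.
  rewrite sxs; apply: (leq_trans (size_polyD _ _)); rewrite geq_max size_polyN sP andbT.
  apply: (leq_trans (size_sum _ _ _)); apply/bigmax_leqP_seq => x xin _.
  by apply: (leq_trans (size_scale_leq _ _)); rewrite sizeB.
rewrite -[in RHS]LP /L coef_sum; apply: eq_big_seq => x xin; rewrite coefZ.
have /monicP : B x \is monic by exact: monic_prod_XsubC.
by rewrite /lead_coef sizeB //= => ->; rewrite mulr1.
Qed.

Hypothesis q0 : q != 0.

Definition rfac (x y : F) : F := (x - q * y) / (x - y).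

(* Interpolation of [\prod_(y <- xs) (y - q * x)] at the nodes [0] and [xs]. *)
Lemma sum_rfac_seq (xs : seq F) : uniq xs -> 0 \notin xs ->
  (1 - q) * \sum_(x <- xs) \prod_(y <- xs | y != x) rfac y x = 1 - q ^+ size xs.
Proof.
move=> uxs xs0; set n := size xs.
pose P : {poly F} := (- q) ^+ n *: \prod_(y <- [seq y / q | y <- xs]) ('X - y%:P).
have PE x : P.[x] = \prod_(y <- xs) (y - q * x).
  rewrite hornerZ horner_prod big_map.
  have -> : (- q) ^+ n = \prod_(y <- xs) (- q) by rewrite big_const_seq count_predT iter_mulr_1.
  rewrite -big_split /=; apply: eq_bigr => y _; rewrite !hornerE.
  by field.
have sP : size P = n.+1.
  by rewrite size_scale ?expf_neq0 ?oppr_eq0 // size_prod_XsubC size_map.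
have Pn : P`_n = (- q) ^+ n.
  rewrite coefZ; have := monic_prod_XsubC [seq y / q | y <- xs] xpredT id.
  rewrite monicE /lead_coef size_prod_XsubC size_map /= -/n => /eqP ->.
  by rewrite mulr1.
have := @lagrange_lead (0 :: xs) P n; rewrite /= xs0 uxs sP leqnn => /(_ isT erefl isT).
rewrite Pn big_cons big_cons eqxx /=.
have nzx y : y \in xs -> y != 0 by move=> yin; apply: contraNneq xs0 => <-.
have -> : P.[0] / \prod_(y <- xs | y != 0) (0 - y) = (-1) ^+ n.
  rewrite PE (eq_big_seq id) => [|y yin]; last by rewrite mulr0 subr0.
  have -> : \prod_(y <- xs | y != 0) (0 - y) = (-1) ^+ n * \prod_(y <- xs) y.
    have -> : (-1) ^+ n = \prod_(y <- xs) (-1 : F) by rewrite big_const_seq count_predT iter_mulr_1.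
    rewrite -big_split big_seq_cond [RHS]big_seq /=; apply: eq_big => y.
      by case yin: (y \in xs) => //=; rewrite nzx.
    by rewrite sub0r mulN1r.
  have p0 : \prod_(y <- xs) y != 0.
    by rewrite prodf_seq_neq0; apply/allP => y /nzx.
  by rewrite invfM mulrCA divff // mulr1 -exprVn invrN invr1.
have -> : \sum_(x <- xs) P.[x] / \prod_(y <- 0 :: xs | y != x) (x - y) =
    - (-1) ^+ n * ((1 - q) * \sum_(x <- xs) \prod_(y <- xs | y != x) rfac y x).
  rewrite !mulr_sumr; apply: eq_big_seq => x xin.
  rewrite big_cons eq_sym nzx // subr0 PE (bigD1_seq x) //=.
  have -> : \prod_(y <- xs | y != x) rfac y x =
     (- (-1) ^+ n) * (\prod_(y <- xs | y != x) (y - q * x) / \prod_(y <- xs | y != x) (x - y)).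
    have -> : - (-1) ^+ n = (\prod_(y <- xs | y != x) (-1 : F)).
      rewrite big_const_seq iter_mulr_1.
      have := count_predC (pred1 x) xs; rewrite count_uniq_mem // xin add1n -/n => <-.
      by rewrite exprS mulN1r opprK.
    rewrite -prodf_div -big_split /=; apply: eq_bigr => y yx; rewrite /rfac.
    by rewrite -[y - x]opprB invrN mulrN mulN1r.
  have x0 := nzx x xin; set D := \prod_(y <- xs | y != x) (x - y).
  have D0 : D != 0.
    by rewrite prodf_seq_neq0; apply/allP => y _; apply/implyP; rewrite subr_eq0 eq_sym.
  have ee : (-1) ^+ n * (-1) ^+ n = 1 :> F by rewrite -expr2 sqrr_sign.
  rewrite -[LHS]mul1r -[X in X * _ = _]ee.
  move: ((-1) ^+ n) (\prod_(y <- xs | y != x) (y - q * x)) => e G.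
  by field; rewrite x0 D0.
(* With [S] the sum to compute, node 0 contributes [(-1)^n], the other nodes [-(-1)^n (1 - q) S],
   and the leading coefficient is [(-q)^n]; clearing the sign gives [1 - (1 - q) S = q^n]. *)
move=> h; have := congr1 (fun z => (-1) ^+ n * z) h.
rewrite mulrDr mulNr mulrN mulrA -expr2 sqrr_sign mul1r -exprMn mulrNN mul1r => h1.
by rewrite -h1 subKr.
Qed.

Lemma sum_rfac (T : finType) (P : pred T) (u : T -> F) : {in P &, injective u} ->
  (forall i, P i -> u i != 0) ->
  (1 - q) * \sum_(j | P j) \prod_(i | P i && (i != j)) rfac (u i) (u j) = 1 - q ^+ #|P|.
Proof.
move=> iu nu; have := @sum_rfac_seq [seq u i | i <- enum P].
rewrite map_inj_in_uniq ?enum_uniq; last by move=> x y; rewrite !mem_enum; exact: iu.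
move=> /(_ isT); rewrite size_map -cardE => <-; last first.
  by apply/negP => /mapP[j]; rewrite mem_enum => /nu h h0; rewrite -h0 eqxx in h.
congr (_ * _); rewrite big_map big_enum; apply: eq_bigr => j Pj.
rewrite big_map big_enum_cond; apply: eq_bigl => i /=.
case Pi: (i \in P); rewrite -[P i]/(i \in P) Pi //=.
by congr (~~ _); apply/eqP/eqP => [->//|]; exact: iu.
Qed.

(** Lists each pair of values with the smaller one first, so that the product can be compared pair
    by pair with the prefactor; the inversions of the inverse permutation are the pairs that get
    swapped. *)
Lemma prod_pairs_perm n (s : 'S_n) (h : 'I_n -> 'I_n -> F) :
  \prod_(a < n) \prod_(b < n | (a < b)%N) h (s a) (s b) =
  \prod_(c < n) \prod_(d < n | (c < d)%N)
     (if (s^-1%g c < s^-1%g d)%N then h c d else h d c).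
Proof.
have -> : \prod_(a < n) \prod_(b < n | (a < b)%N) h (s a) (s b) =
   \prod_(c < n) \prod_(d < n | (s^-1%g c < s^-1%g d)%N) h c d.
  rewrite [RHS](reindex_inj (@perm_inj _ s)) /=; apply: eq_bigr => a _.
  rewrite [RHS](reindex_inj (@perm_inj _ s)) /=; apply: eq_bigl => b.
  by rewrite !permK.
pose A := \prod_(c < n) \prod_(d < n | (c < d)%N && (s^-1%g c < s^-1%g d)%N) h c d.
have E1 : \prod_(c < n) \prod_(d < n | (s^-1%g c < s^-1%g d)%N) h c d =
  A * \prod_(c < n) \prod_(d < n | (d < c)%N && (s^-1%g c < s^-1%g d)%N) h c d.
  rewrite /A -big_split; apply: eq_bigr => c _ /=.
  rewrite (bigID (fun d : 'I_n => (c < d)%N)) /=; congr (_ * _).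
    by apply: eq_bigl => d; rewrite andbC.
  apply: eq_bigl => d; have [->|dc] := eqVneq d c; first by rewrite !ltnn.
  by rewrite -leqNgt [(d <= c)%N]leq_eqVlt val_eqE (negPf dc) andbC.
rewrite {}E1 [X in _ * X](exchange_big_dep xpredT) //= /A -big_split; apply: eq_bigr => c _ /=.
rewrite [RHS](bigID (fun d : 'I_n => (s^-1%g c < s^-1%g d)%N)) /=; congr (_ * _).
  by apply: eq_bigr => d /andP[_ ->].
apply: eq_big => d.
  have [->|dc] := eqVneq d c; first by rewrite !ltnn.
  have : s^-1%g d != s^-1%g c by rewrite (inj_eq perm_inj).
  by rewrite -leqNgt [(s^-1%g d <= s^-1%g c)%N]leq_eqVlt val_eqE => /negPf ->.
by move=> /andP[_ h1]; rewrite ltnNge (ltnW h1).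
Qed.

Lemma lift_perm_surj n (i j : 'I_n.+1) (s : 'S_n.+1) : s i = j ->
  exists t : 'S_n, s = lift_perm i j t.
Proof.
move=> sij; pose f k := odflt k (unlift j (s (lift i k))).
have fE k : lift j (f k) = s (lift i k).
  rewrite /f; case: unliftP => [k' -> //|/eqP].
  by rewrite -sij (inj_eq perm_inj) eq_sym (negPf (neq_lift _ _)).
have fi : injective f.
  by move=> k k' /(congr1 (lift j)); rewrite !fE => /perm_inj/lift_inj.
exists (perm fi); apply/permP => k; case: (unliftP i k) => [k' ->|->].
  by rewrite lift_perm_lift permE fE.
by rewrite lift_perm_id.
Qed.

Lemma prod_pairs_recr n (E : rel 'I_n.+1) (h : 'I_n.+1 -> 'I_n.+1 -> F) :
  \prod_(a < n.+1) \prod_(b < n.+1 | (a < b)%N && E a b) h a b =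
  (\prod_(a < n) \prod_(b < n | (a < b)%N && E (lift ord_max a) (lift ord_max b))
     h (lift ord_max a) (lift ord_max b)) *
  \prod_(a < n | E (lift ord_max a) ord_max) h (lift ord_max a) ord_max.
Proof.
have wE (a : 'I_n) : widen_ord (leqnSn n) a = lift ord_max a.
  by apply: val_inj; rewrite /= /bump leqNgt ltn_ord.
rewrite big_ord_recr /= [X in _ * X]big_pred0 ?mulr1; last first.
  by move=> b; rewrite ltnNge -ltnS ltn_ord.
rewrite [X in _ * X]big_mkcond /= -big_split /=; apply: eq_bigr => a _.
rewrite big_mkcond big_ord_recr /= -big_mkcond /= ltn_ord /= wE.
by congr (_ * _); apply: eq_big => b; rewrite wE.
Qed.

Variable l : nat -> nat.
Hypothesis l_noninc : forall i j, (i <= j)%N -> (l j <= l i)%N.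
Hypothesis q1 : q != 1.

(** Factor [i] is the q-integer of the rank of [i] inside its block, so the product is a q-factorial
    for each block. *)
Definition symm_const n : F :=
  \prod_(i < n) ((1 - q ^+ (\sum_(j < i.+1) (l j == l i))) / (1 - q)).

(** From [j] up to [n] the sequence [l] is constant, so deleting position [j] amounts to deleting
    the last one. This lets a permutation stabilizing [l] and sending the last index to [j] restrict
    to a stabilizing one on [n] indices. *)
Lemma noninc_lift n (j : 'I_n.+1) (i : 'I_n) : l j = l n -> l (lift j i) = l i.
Proof.
move=> lj; rewrite /= /bump; case: leqP => //= ji; rewrite add1n.
have h1 := l_noninc ji; have h2 := l_noninc (leqnSn i).
have h3 : (l n <= l i.+1)%N by apply: l_noninc.
by apply/eqP; rewrite eqn_leq h2 /= (leq_trans h1) // lj.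
Qed.

(** Group the permutations by the image [j] of the last index, which ranges over the last block.
    Pairs containing the last position give the product over the rest of the block, summed over [j]
    by [sum_rfac]; the other pairs give the constant of size [n], the same for every [j]. *)
Lemma symmetrization n (u : 'I_n -> F) : injective u -> (forall i, u i != 0) ->
  \sum_(s : 'S_n | [forall i, l (s i) == l i])
    \prod_(a < n) \prod_(b < n | (a < b)%N && (l a == l b)) rfac (u (s a)) (u (s b)) =
  symm_const n.
Proof.
elim: n u => [|n IH] u iu nu.
  rewrite /symm_const big_ord0 (big_pred1 1%g) ?big_ord0 // => s.
  have -> : s = 1%g by apply/permP => -[].
  by rewrite /= eqxx; apply/forallP => -[].
have q10 : 1 - q != 0 by rewrite subr_eq0 eq_sym.
rewrite /symm_const big_ord_recr /= -/(symm_const n).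
rewrite (partition_big (fun s : 'S_n.+1 => s ord_max) (fun j => l j == l n)) /=; last first.
  by move=> s /forallP/(_ ord_max).
pose P (j : 'I_n.+1) := l j == l n.
have -> : (\sum_(j < n.+1) (l j == l n))%N = #|P|.
  rewrite -sum1_card [RHS]big_mkcond; apply: eq_bigr => j _.
  by rewrite -[j \in P]/(l j == l n); case: eqP.
have key (j : 'I_n.+1) : P j ->
    \sum_(s : 'S_n.+1 | [forall i, l (s i) == l i] && (s ord_max == j))
      \prod_(a < n.+1) \prod_(b < n.+1 | (a < b)%N && (l a == l b)) rfac (u (s a)) (u (s b)) =
    \prod_(i | P i && (i != j)) rfac (u i) (u j) * symm_const n.
  move=> /eqP Pj.
  have lmax (i : 'I_n) : l (lift ord_max i) = l i by rewrite lift_max.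
  rewrite -(IH (u \o lift j)); first last.
  - by move=> i; exact: nu.
  - by move=> i i' /iu/lift_inj.
  rewrite mulr_sumr.
  transitivity (\sum_(s in [set lift_perm ord_max j t | t : 'S_n & [forall i, l (t i) == l i]])
      \prod_(a < n.+1) \prod_(b < n.+1 | (a < b)%N && (l a == l b)) rfac (u (s a)) (u (s b))).
    apply: eq_bigl => s; apply/andP/imsetP => [[/forallP hs /eqP sj]|[t]].
      have [t st] := lift_perm_surj sj; exists t => //; rewrite inE; apply/forallP => i.
      by have := hs (lift ord_max i); rewrite st lift_perm_lift noninc_lift // lmax.
    rewrite inE => /forallP ht ->; rewrite lift_perm_id eqxx; split => //.
    apply/forallP => i; case: (unliftP ord_max i) => [i' ->|->].
      by rewrite lift_perm_lift noninc_lift // lmax.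
    by rewrite lift_perm_id Pj.
  rewrite big_imset /=; last first.
    move=> t t' _ _ /permP h; apply/permP => k; apply: (@lift_inj _ j).
    by rewrite -!(lift_perm_lift ord_max) h.
  rewrite (eq_bigl (fun t : 'S_n => [forall i, l (t i) == l i])); last by move=> t; rewrite inE.
  apply: eq_bigr => t /forallP ht; rewrite prod_pairs_recr mulrC; congr (_ * _).
    rewrite (eq_bigl (fun a : 'I_n => l (t a) == l n)); last first.
      by move=> a; rewrite lmax (eqP (ht a)).
    under eq_bigr do rewrite lift_perm_lift lift_perm_id.
    transitivity (\prod_(c < n | l c == l n) rfac (u (lift j c)) (u j)).
      by rewrite [RHS](reindex_inj (@perm_inj _ t)).
    pose G i := if i == j then 1 else rfac (u i) (u j).
    have := @bigD1_ord _ *%R 1 n.+1 j P G; rewrite /P Pj eqxx => /(_ isT).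
    rewrite (bigD1 j) /= ?Pj //= {1 3}/G eqxx !mul1r => h.
    transitivity (\prod_(i < n | l (lift j i) == l n) G (lift j i)).
      apply: eq_big => i; first by rewrite noninc_lift.
      by move=> _; rewrite /G eq_sym (negPf (neq_lift _ _)).
    rewrite -h; apply: eq_bigr => i /andP[_ /negPf ij].
    by rewrite /G ij.
  apply: eq_bigr => a _; apply: eq_big => b; first by rewrite !lmax.
  by rewrite !lift_perm_lift.
rewrite (eq_bigr _ key) -mulr_suml mulrC; congr (_ * _).
apply: (mulfI q10); rewrite (@sum_rfac _ P u) //; last by move=> i j _ _; exact: iu.
by rewrite mulrCA divff // mulr1.
Qed.
End Symmetrization.

(** * Algebraic form of the integrand and of the constants *)

Section RationalAlgebra.
Variables (F : fieldType) (q : F).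

Definition prefactor k (u : 'I_k -> F) : F :=
  \prod_(a < k) \prod_(b < k | (a < b)%N) ((u a - u b) / (u a - q * u b)).

(** A pair in the right order cancels its prefactor completely; an inverted pair cancels only the
    difference [u_a - u_b]. No pole on the diagonals remains. *)
Lemma prefactor_perm k (u : 'I_k -> F) (s : 'S_k) :
  (forall a b : 'I_k, (a < b)%N -> u a - u b != 0 /\ u a - q * u b != 0) ->
  prefactor u * \prod_(a < k) \prod_(b < k | (a < b)%N) rfac q (u (s a)) (u (s b)) =
  \prod_(a < k) \prod_(b < k | (a < b)%N && (s^-1%g b < s^-1%g a)%N)
     ((q * u a + -1 * u b) / (u a - q * u b)).
Proof.
move=> nz; rewrite (prod_pairs_perm s (fun c d => rfac q (u c) (u d))).
rewrite /prefactor -big_split; apply: eq_bigr => a _ /=.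
rewrite -big_split big_mkcondr /=; apply: eq_bigr => b ab; have [n1 n2] := nz a b ab.
have n3 : u b - u a != 0 by rewrite -opprB oppr_eq0.
rewrite /rfac; case: ltngtP => [h|h|/val_inj/perm_inj h].
- by field; rewrite n1 n2.
- by field; rewrite n2 n3.
- by move: ab; rewrite h ltnn.
Qed.

(** A permutation preserving the blocks never reverses two indices of different blocks, so those
    pairs cancel as for the identity. In-block pairs are left uncancelled, so that the part
    depending on [s] can be summed by [symmetrization]. *)
Lemma prefactor_stab k (u : 'I_k -> F) (s : 'S_k) (l : nat -> nat) :
  (forall i j, (i <= j)%N -> (l j <= l i)%N) -> (forall i, l (s i) = l i) ->
  (forall a b : 'I_k, (a < b)%N -> u a - u b != 0 /\ u a - q * u b != 0) ->
  prefactor u * \prod_(a < k) \prod_(b < k | (a < b)%N) rfac q (u (s a)) (u (s b)) =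
  (\prod_(a < k) \prod_(b < k | (a < b)%N && (l a == l b))
     ((1 * u a + -1 * u b) / (u a - q * u b))) *
  \prod_(a < k) \prod_(b < k | (a < b)%N && (l a == l b)) rfac q (u (s a)) (u (s b)).
Proof.
move=> l_ni ls nz.
pose same (h : 'I_k -> 'I_k -> F) := \prod_(a < k) \prod_(b < k | (a < b)%N && (l a == l b)) h a b.
pose diff (h : 'I_k -> 'I_k -> F) := \prod_(a < k) \prod_(b < k | (a < b)%N)
   (if l a == l b then 1 else h a b).
have split h : \prod_(a < k) \prod_(b < k | (a < b)%N) h a b = same h * diff h.
  rewrite /same /diff -big_split; apply: eq_bigr => a _ /=.
  rewrite [X in X * _]big_mkcondr -big_split; apply: eq_bigr => b _ /=.
  by case: ifP; rewrite ?mulr1 ?mul1r.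
have lsV i : l (s^-1%g i) = l i by rewrite -{2}(permKV s i) ls.
have diffs : diff (fun a b => rfac q (u (s a)) (u (s b))) = diff (fun a b => rfac q (u a) (u b)).
  rewrite /diff.
  pose h (c d : 'I_k) := if l c == l d then 1 else rfac q (u c) (u d).
  transitivity (\prod_(a < k) \prod_(b < k | (a < b)%N) h (s a) (s b)).
    by apply: eq_bigr => a _; apply: eq_bigr => b _ /=; rewrite /h !ls.
  rewrite prod_pairs_perm /h; apply: eq_bigr => c _; apply: eq_bigr => d cd.
  case: ifPn => //; rewrite -leqNgt => /l_ni; rewrite !lsV => h2.
  have -> : l c = l d by apply/eqP; rewrite eqn_leq h2 l_ni // ltnW.
  by rewrite eqxx.
rewrite /prefactor !split diffs [LHS]mulrACA.
have -> : diff (fun a b => (u a - u b) / (u a - q * u b)) *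
          diff (fun a b => rfac q (u a) (u b)) = 1.
  rewrite /diff -big_split big1 // => a _ /=; rewrite -big_split big1 // => b ab /=.
  have [n1 n2] := nz a b ab; case: ifP => _; first by rewrite mulr1.
  by rewrite /rfac; field; rewrite n1 n2.
rewrite mulr1; congr (_ * _); apply: eq_bigr => a _; apply: eq_bigr => b _.
by rewrite mul1r mulN1r.
Qed.

Variables xi s : nat -> F.
Hypotheses (xi0 : forall j, xi j != 0) (s0 : forall j, s j != 0).

Definition inner_pole j : F := (xi j)^-1 * s j.
Definition outer_pole j : F := (xi j)^-1 * (s j)^-1.

Definition wfun j (u : F) : F := (1 - s j * xi j * u)^-1.

(* The product of [phi_l] and the dual [phi_m] after cancelling common factors. *)
Definition phi_pair l m u : F := (1 - q) ^+ 2 *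
  (if (l < m)%N then (xi l)^-1 * ((u - inner_pole m)^-1 * (u - inner_pole l)^-1) *
     \prod_(l.+1 <= j < m) ((- s j * u + (xi j)^-1) / (u - inner_pole j))
   else if (m < l)%N then xi m * (wfun l u * wfun m u) *
     \prod_(m.+1 <= j < l) ((- s j + xi j * u) * wfun j u)
   else wfun l u * (u - inner_pole l)^-1).

(** The [j]-th factors of the two products, [A j] and [B j], are inverse to each other, so only the
    indices between [l] and [m] survive. The first unmatched factor also cancels a denominator: for
    [l < m] all poles are inner and the decay is [u^-2], for [m < l] all are outer. *)
Lemma phi_dual_phi l m u : u != 0 -> (forall j, u - inner_pole j != 0) ->
  (forall j, 1 - s j * xi j * u != 0) ->
  phi q xi s l u * (u^-1 * phi q (fun j => (xi j)^-1) s m u^-1) = phi_pair l m u.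
Proof.
move=> u0 nin nout.
pose A j := (xi j * u - s j) / (1 - s j * xi j * u).
pose B j := (- s j * u + (xi j)^-1) / (u - inner_pole j).
have nA j : xi j * u - s j != 0.
  have -> : xi j * u - s j = xi j * (u - inner_pole j) by rewrite /inner_pole mulrBr mulVKf.
  by rewrite mulf_neq0.
have nU j : 1 - s j * (xi j)^-1 * u^-1 != 0.
  have -> : 1 - s j * (xi j)^-1 * u^-1 = (u - inner_pole j) / u.
    by rewrite /inner_pole; field; rewrite xi0 u0.
  by rewrite mulf_neq0 ?invr_neq0.
have AB j : A j * B j = 1.
  have -> : B j = (1 - s j * xi j * u) / (xi j * u - s j).
    by rewrite /B /inner_pole; field; rewrite xi0 ?nA //; have := nin j; rewrite /inner_pole mulrC.
  by rewrite /A mulrA divfK // divff.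
have -> : phi q xi s l u = (1 - q) * wfun l u * \prod_(0 <= j < l) A j.
  by rewrite /phi big_mkord.
have -> : u^-1 * phi q (fun j => (xi j)^-1) s m u^-1 =
    (1 - q) * (u - inner_pole m)^-1 * \prod_(0 <= j < m) B j.
  rewrite /phi big_mkord mulrA; congr (_ * _).
    have -> : 1 - s m / xi m / u = (u - inner_pole m) / u.
      by rewrite /inner_pole; field; rewrite xi0 u0.
    by rewrite invfM invrK [_^-1 * u]mulrC mulrCA mulKf.
  apply: eq_bigr => j _; rewrite /B.
  have -> : 1 - s j / xi j / u = (u - inner_pole j) / u.
    by rewrite /inner_pole; field; rewrite xi0 u0.
  rewrite invfM invrK [_^-1 * u]mulrC mulrA; congr (_ * _).
  by field; rewrite xi0 u0.
have cancel n : (\prod_(0 <= j < n) A j) * (\prod_(0 <= j < n) B j) = 1.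
  by rewrite -big_split big1 // => j _; exact: AB.
rewrite /phi_pair; case: ltngtP => [lm|ml|->].
- rewrite (big_cat_nat (leq0n l) (ltnW lm)) /= (big_ltn lm).
  have -> : B l * \prod_(l.+1 <= i < m) B i = (xi l)^-1 * (wfun l u)^-1 * (u - inner_pole l)^-1 *
     \prod_(l.+1 <= i < m) B i.
    congr (_ * _); rewrite /B; congr (_ * _); rewrite /wfun invrK mulrBr mulr1.
    by rewrite -mulrA mulrCA mulKf // mulNr addrC.
  have wn : wfun l u != 0 by rewrite invr_neq0.
  transitivity ((1 - q) ^+ 2 * (wfun l u * (wfun l u)^-1) *
     ((\prod_(0 <= j < l) A j) * (\prod_(0 <= j < l) B j)) *
     ((xi l)^-1 * ((u - inner_pole m)^-1 * (u - inner_pole l)^-1) *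
     \prod_(l.+1 <= j < m) B j)); first by rewrite expr2; ring.
  by rewrite divff // cancel !mulr1.
- rewrite (big_cat_nat (leq0n m) (ltnW ml)) /= (big_ltn ml).
  have -> : A m * \prod_(m.+1 <= i < l) A i = xi m * (u - inner_pole m) * wfun m u *
     \prod_(m.+1 <= i < l) A i.
    by congr (_ * _); rewrite /A /inner_pole mulrBr mulVKf.
  have -> : \prod_(m.+1 <= j < l) ((- s j + xi j * u) * wfun j u) = \prod_(m.+1 <= j < l) A j.
    by apply: eq_bigr => j _; rewrite /A addrC.
  transitivity ((1 - q) ^+ 2 * ((u - inner_pole m) * (u - inner_pole m)^-1) *
     ((\prod_(0 <= j < m) A j) * (\prod_(0 <= j < m) B j)) *
     (xi m * (wfun l u * wfun m u) * \prod_(m.+1 <= j < l) A j)); first by rewrite expr2; ring.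
  by rewrite divff // cancel !mulr1.
- transitivity ((1 - q) ^+ 2 * ((\prod_(0 <= j < m) A j) * (\prod_(0 <= j < m) B j)) *
    (wfun m u * (u - inner_pole m)^-1)); first by rewrite expr2; ring.
  by rewrite cancel mulr1.
Qed.

Lemma qpochS (z : F) n : qpoch q z n.+1 = qpoch q z n * (1 - z * q ^+ n).
Proof. by rewrite /qpoch big_ord_recr. Qed.

Definition mult (l : nat -> nat) n j := (\sum_(i < n) (l i == j))%N.

Lemma multS l n j : mult l n.+1 j = (mult l n j + (l n == j))%N.
Proof. by rewrite /mult big_ord_recr. Qed.

Hypothesis q1 : q != 1.

Lemma symm_const_qpoch (l : nat -> nat) n B : (forall i, (i < n)%N -> (l i < B)%N) ->
  (1 - q) ^+ n * symm_const q l n = \prod_(j < B) qpoch q q (mult l n j).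
Proof.
have q10 : 1 - q != 0 by rewrite subr_eq0 eq_sym.
elim: n => [|n IH] hB.
  rewrite /symm_const big_ord0 expr0 mulr1 big1 // => j _.
  by rewrite /mult big_ord0 /qpoch big_ord0.
have lB := hB n (ltnSn n).
rewrite /symm_const big_ord_recr /= -/(symm_const q l n).
rewrite (bigD1 (Ordinal lB)) //= multS eqxx addn1 qpochS.
rewrite (eq_bigr (fun j : 'I_B => qpoch q q (mult l n j))); last first.
  move=> j /eqP jl; rewrite multS; case: eqP => [lj|_]; last by rewrite addn0.
  by case: jl; exact: val_inj.
have {}IH := IH (fun i iln => hB i (ltnW iln)).
rewrite (bigD1 (Ordinal lB)) //= in IH.
rewrite mulrAC -IH exprSr -/(mult l n.+1 (l n)) multS eqxx addn1 exprS.
by field.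
Qed.

(** Absent parts have multiplicity 0 and contribute 1, so the product may run up to any bound on the
    parts, the form shared by the other two constants. *)
Lemma cS_mult k (lam : k.-tuple nat) B : (forall i, (nth 0 lam i < B)%N) ->
  cS q s lam = \prod_(j < B) (qpoch q (s j ^+ 2) (mult (nth 0%N lam) k j) /
                              qpoch q q (mult (nth 0%N lam) k j)).
Proof.
move=> hB; have multE j : mult (nth 0%N lam) k j = count_mem j lam.
  rewrite -sum1_count (big_nth 0%N) size_tuple big_mkord [RHS]big_mkcond /=.
  by apply: eq_bigr => i _ /=; case: eqP.
under [RHS]eq_bigr do rewrite multE.
rewrite -(big_mkord xpredT
  (fun j => qpoch q (s j ^+ 2) (count_mem j lam) / qpoch q q (count_mem j lam))).
rewrite (bigID (mem (undup lam))) /= [X in _ * X]big1 ?mulr1; last first.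
  move=> j; rewrite mem_undup => /count_memPn ->.
  by rewrite /qpoch !big_ord0 divr1.
rewrite /cS -[RHS]big_filter; apply: perm_big; apply: uniq_perm.
- exact: undup_uniq.
- by apply: filter_uniq; exact: iota_uniq.
move=> j; rewrite mem_filter mem_index_iota /=; case jl: (j \in undup lam) => //=.
by move: jl; rewrite mem_undup => /(nthP 0%N)[i _ <-]; rewrite hB.
Qed.

End RationalAlgebra.

(** * Evaluation of the telescoping residues *)

Section DiagonalValue.
Variables (R : realType) (q : R[i]) (xi s : nat -> R[i]).
Hypotheses (xi0 : forall j, xi j != 0).
Hypothesis sq1 : forall j n, 1 - s j ^+ 2 * q ^+ n != 0.

(** At the pole [q^e s_j / xi_j], [wfun] equals [1 / (1 - s_j^2 q^e)], the inverse of the next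
    factor of the q-Pochhammer symbol. The shift [e] is arbitrary because each step raises it. *)
Lemma diag_value_qpoch (l : nat -> nat) n B e : (forall i, (i < n)%N -> (l i < B)%N) ->
  diag_value q l (inner_pole xi s) (wfun xi s) n e *
    \prod_(j < B) qpoch q (s j ^+ 2) (e j + mult l n j)%N =
  \prod_(j < B) qpoch q (s j ^+ 2) (e j).
Proof.
elim: n e => [|n IH] e hB /=.
  by rewrite mul1r; apply: eq_bigr => j _; rewrite /mult big_ord0 addn0.
have lB := hB n (ltnSn n).
have {}IH := IH (incr_at e (l n)) (fun i iln => hB i (ltnW iln)).
have -> : \prod_(j < B) qpoch q (s j ^+ 2) (e j + mult l n.+1 j)%N =
          \prod_(j < B) qpoch q (s j ^+ 2) (incr_at e (l n) j + mult l n j)%N.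
  apply: eq_bigr => j _; congr qpoch; rewrite multS /incr_at [(_ == l n)]eq_sym.
  by rewrite addnA addnAC.
rewrite -mulrA IH (bigD1 (Ordinal lB)) //= [in RHS](bigD1 (Ordinal lB)) //=.
rewrite (eq_bigr (fun j : 'I_B => qpoch q (s j ^+ 2) (e j))); last first.
  move=> j /eqP jl; rewrite /incr_at; case: eqP => [lj|_]; last by rewrite addn0.
  by case: jl; exact: val_inj.
rewrite /incr_at eqxx addn1 qpochS /wfun /inner_pole.
have -> : s (l n) * xi (l n) * (q ^+ e (l n) * ((xi (l n))^-1 * s (l n))) =
          s (l n) ^+ 2 * q ^+ e (l n) by field.
by rewrite mulrA [_ * (1 - _)]mulrC mulKf.
Qed.
End DiagonalValue.

(** * Mismatches between sorted sequences, and nonvanishing of the constants *)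

Lemma sorted_geq_noninc k (lam : k.-tuple nat) : is_sign lam ->
  forall i j, (i <= j)%N -> (nth 0 lam j <= nth 0 lam i)%N.
Proof.
move=> sl i j ij; have [js|js] := ltnP j (size lam); last by rewrite nth_default.
have geq_trans : transitive geq by move=> a b c h1 h2; exact: leq_trans h2 h1.
have := sorted_leq_nth geq_trans leqnn 0%N sl; apply => //.
by rewrite inE (leq_ltn_trans ij js).
Qed.

(* A mismatch at [i] propagates to a left-to-right maximum or to a right-to-left
   minimum of [t]. *)
Lemma mismatch_extremal n (t : 'S_n) (L M : nat -> nat) (i : 'I_n) :
  (forall i j, (i <= j)%N -> (L j <= L i)%N) -> (forall i j, (i <= j)%N -> (M j <= M i)%N) ->
  L (t i) != M i ->
  (exists2 j : 'I_n, (L (t j) < M j)%N & forall a : 'I_n, (a < j)%N -> ~~ (t j < t a)%N) \/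
  (exists2 j : 'I_n, (M j < L (t j))%N & forall b : 'I_n, (j < b)%N -> ~~ (t b < t j)%N).
Proof.
move=> L_ni M_ni; rewrite neq_ltn => /orP[h|h]; [left|right].
  have [j ji jmax] := @arg_maxnP _ i (fun x : 'I_n => (x <= i)%N) (fun x => t x) (leqnn i).
  exists j.
    by apply: leq_ltn_trans (L_ni _ _ (jmax i (leqnn i))) (leq_trans h (M_ni _ _ ji)).
  by move=> a aj; rewrite -leqNgt; apply: jmax; rewrite (leq_trans (ltnW aj)).
have [j ij jmin] := @arg_minnP _ i (fun x : 'I_n => (i <= x)%N) (fun x => t x) (leqnn i).
exists j.
  by apply: leq_ltn_trans (M_ni _ _ ij) (leq_trans h (L_ni _ _ (jmin i (leqnn i)))).
by move=> b jb; rewrite -leqNgt; apply: jmin; rewrite (leq_trans ij) // ltnW.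
Qed.

Lemma realC_neq1 (R : realType) (q : R) : q < 1 -> 1 - q%:C != 0 :> R[i].
Proof.
by move=> q1; rewrite -(rmorph1 (real_complex R)) -rmorphB fmorph_eq0 subr_eq0 gt_eqF.
Qed.

Lemma one_sub_sqr_exp_neq0 (R : realType) (q x : R) n : 0 < q < 1 -> -1 < x < 0 ->
  1 - x%:C ^+ 2 * q%:C ^+ n != 0 :> R[i].
Proof.
move=> /andP[q0 q1] /andP[x1 x0]; rewrite -!rmorphXn -rmorphM; apply: realC_neq1.
have h1 : x ^+ 2 < 1 by rewrite expr2; nra.
have h2 : q ^+ n <= 1 by apply: exprn_ile1; exact: ltW.
by apply: le_lt_trans h1; rewrite ler_piMr ?sqr_ge0.
Qed.

Lemma qpoch_q_neq0 (R : realType) (q : R) n : 0 < q < 1 -> qpoch q%:C q%:C n != 0 :> R[i].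
Proof.
move=> /andP[q0 q1]; apply/prodf_neq0 => i _; rewrite -exprS -rmorphXn.
by apply: realC_neq1; rewrite exprn_ilt1 // ltW.
Qed.

(** * The integral of each permutation and the diagonal sum *)

Section Orthogonality.
Variables (R : realType) (q : R) (xi s : nat -> R) (gam : nat -> R -> R[i]) (k : nat).
Local Notation C := R[i].
Hypothesis q01 : 0 < q < 1.
Hypothesis xi_gt0 : forall j, 0 < xi j.
Hypothesis s_lt0 : forall j, -1 < s j < 0.
Hypothesis gamP : forall i, (i < k)%N -> contour (gam i).
Hypothesis gam_in : forall i j, (i < k)%N -> curve_interior (gam i) ((xi j)^-1 * s j)%:C.
Hypothesis gam_out : forall i j, (i < k)%N -> curve_exterior (gam i) ((xi j)^-1 * (s j)^-1)%:C.
Hypothesis gam_nest : forall i j, (i < j < k)%N -> forall z, trace (gam j) z ->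
  curve_interior (gam i) (q%:C * z).

Let qC : C := q%:C.
Let xiC j : C := (xi j)%:C.
Let sC j : C := (s j)%:C.
Let In i := curve_interior (gam i).
Let Out i := curve_exterior (gam i).
Let a := inner_pole xiC sC.

Let q_gt0 : 0 < q. Proof. by case/andP: q01. Qed.
Let realC_neq0 (x : R) : x != 0 -> x%:C != 0 :> C.
Proof. by move=> x0; rewrite fmorph_eq0. Qed.
Let qC0 : qC != 0. Proof. by apply: realC_neq0; rewrite gt_eqF. Qed.
Let xi0 j : xiC j != 0. Proof. by apply: realC_neq0; rewrite gt_eqF. Qed.
Let s0 j : sC j != 0.
Proof. by apply: realC_neq0; rewrite lt_eqF //; case/andP: (s_lt0 j). Qed.
Let q1 : qC != 1.
Proof. by rewrite eq_sym -subr_eq0 realC_neq1 //; case/andP: q01. Qed.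

Let cg i : (i < k)%N -> closed_curve (gam i).
Proof. by move=> /gamP[/simple_closed_curve_closed]. Qed.

Let hI i : (i < k)%N -> forall p, In i p -> ~ trace (gam i) p /\ winding_number (gam i) p = 1.
Proof. by move=> /gamP[_ po] p Ip; split; [case: Ip|exact: po]. Qed.

Let hO i : (i < k)%N -> forall p, Out i p -> ~ trace (gam i) p /\ winding_number (gam i) p = 0.
Proof. by move=> ik p Op; split; [case: Op|exact: winding_exterior (cg ik) Op]. Qed.

Let nestI i j : (i < j < k)%N -> forall z, In j z -> In i (qC * z).
Proof.
move=> ijk z; have /andP[ij jk] := ijk; have ik := ltn_trans ij jk.
exact: scaled_interior (cg ik) (cg jk) q_gt0 (gam_nest ijk) _.
Qed.

Let nestO i j : (i < j < k)%N -> forall z, trace (gam i) z -> Out j (z / qC).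
Proof.
move=> ijk z; have /andP[ij jk] := ijk; have ik := ltn_trans ij jk.
exact: trace_scaled_exterior (cg ik) (cg jk) q_gt0 (gam_nest ijk) _.
Qed.

Let inner_in i j : (i < k)%N -> In i (a j).
Proof. by move=> ik; have := gam_in j ik; rewrite rmorphM fmorphV. Qed.

Let ratfun_w i j : (i < k)%N -> ratfun (Out i) (wfun xiC sC j).
Proof.
move=> ik; have Ob : Out i (outer_pole xiC sC j).
  by have := gam_out j ik; rewrite rmorphM !fmorphV.
have -> : wfun xiC sC j = (fun u => - (sC j * xiC j)^-1 * (u - outer_pole xiC sC j)^-1).
  apply/funext => u; rewrite /wfun /outer_pole.
  have -> : 1 - sC j * xiC j * u = - (sC j * xiC j) * (u - (xiC j)^-1 * (sC j)^-1).
    by field; rewrite xi0 s0.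
  by rewrite invfM invrN.
by apply: ratfunM; [exact: ratfun_cst|exact: ratfun_V].
Qed.

Let ratfun_out l m i : (i < k)%N -> (m < l)%N -> ratfun (Out i) (phi_pair qC xiC sC l m).
Proof.
move=> ik ml; rewrite /phi_pair ltnNge (ltnW ml) /= ml.
apply: ratfunM; first exact: ratfun_cst.
apply: ratfunM.
  apply: ratfunM; first exact: ratfun_cst.
  by apply: ratfunM; exact: ratfun_w.
apply: ratfun_prod => j _; apply: ratfunM; [exact: ratfun_affine|exact: ratfun_w].
Qed.

Let ratfun_in l m i : (i < k)%N -> (l < m)%N -> ratfun_decay (In i) (phi_pair qC xiC sC l m).
Proof.
move=> ik lm; rewrite /phi_pair lm.
have -> : (fun u => (1 - qC) ^+ 2 * ((xiC l)^-1 * ((u - a m)^-1 * (u - a l)^-1) *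
     \prod_(l.+1 <= j < m) ((- sC j * u + (xiC j)^-1) / (u - a j)))) =
  (fun u => (((1 - qC) ^+ 2 * (xiC l)^-1) * ((u - a m)^-1 * (u - a l)^-1)) *
     \prod_(l.+1 <= j < m) ((- sC j * u + (xiC j)^-1) / (u - a j))).
  by apply/funext => u; ring.
apply: ratfun_decayM.
  exists ((1 - qC) ^+ 2 * (xiC l)^-1)%:P, [:: a m; a l]; split.
  - by move=> p; rewrite !inE => /orP[] /eqP->; exact: inner_in.
  - exact: leq_ltn_trans (size_polyC_leq1 _) _.
  - by move=> u; rewrite hornerC !big_cons big_nil mulr1 invfM.
elim: (index_iota _ _) => [|j r IH].
  under eq_fun do rewrite big_nil; exists 1, [::]; split => //; first by rewrite size_poly1.
  by move=> u; rewrite hornerC big_nil divr1.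
under eq_fun do rewrite big_cons; apply: ratfun_properM => //.
exact/ratfun_proper_moebius/inner_in.
Qed.

Let ratfun_phi l m i : (i < k)%N ->
  ratfun (fun p => In i p \/ Out i p) (phi_pair qC xiC sC l m).
Proof.
move=> ik; case: (ltngtP l m) => [lm|ml|->].
- by apply: ratfun_sub (ratfun_decayW (ratfun_in ik lm)) => p; left.
- by apply: ratfun_sub (ratfun_out ik ml) => p; right.
rewrite /phi_pair ltnn; apply: ratfunM; first exact: ratfun_cst.
apply: ratfunM; first by apply: ratfun_sub (ratfun_w _ ik) => p; right.
by apply: ratfun_V; left; exact: inner_in.
Qed.

(** The second difference is nonzero because [e x / q] is exterior to the contour on which [e y]
    lies. *)
Lemma generic_pairs e : generic gam k e -> forall x y : 'I_k, (x < y)%N ->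
  e x - e y != 0 /\ e x - qC * e y != 0.
Proof.
move=> [te de _] x y xy; have xyk : (x < y < k)%N by rewrite xy ltn_ord.
rewrite !subr_eq0; split; first exact: de.
apply/eqP => h; have [] := nestO xyk (te _ (ltn_ord x)).
by rewrite h mulrC mulKf // => /(_ (te _ (ltn_ord y))).
Qed.

Lemma generic_poles e i : generic gam k e -> (i < k)%N ->
  [/\ e i != 0, forall j, e i - a j != 0 & forall j, 1 - sC j * xiC j * e i != 0].
Proof.
move=> [te _ ne] ik; split => [|j|j]; first exact: ne.
  have [nt _] := hI ik (inner_in j ik); exact: trace_sub_neq0 nt (te i ik).
have [nt _] := gam_out j ik; rewrite rmorphM !fmorphV in nt.
have := trace_sub_neq0 nt (te i ik); apply: contraNneq => h.
have -> : e i = (xiC j)^-1 * (sC j)^-1.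
  by apply/eqP; rewrite -(inj_eq (mulfI (mulf_neq0 (s0 j) (xi0 j)))); apply/eqP;
     move/eqP: h; rewrite subr_eq0 => /eqP <-; field; rewrite xi0 s0.
by rewrite subrr.
Qed.

Lemma generic0 u : generic gam 0 u.
Proof. by split => // i j; rewrite ltn0 andbF. Qed.

Variables (L M : nat -> nat).
Hypothesis L_ni : forall i j, (i <= j)%N -> (L j <= L i)%N.
Hypothesis M_ni : forall i j, (i <= j)%N -> (M j <= M i)%N.

Definition sigma_term (t : 'S_k) (e : nat -> C) : C :=
  prefactor qC (fun i : 'I_k => e i) *
  (\prod_(x < k) \prod_(y < k | (x < y)%N) rfac qC (e (t x)) (e (t y)) *
   \prod_(i < k) phi qC xiC sC (L i) (e (t i))) *
  \prod_(i < k) ((e i)^-1 * phi qC (fun j => (xiC j)^-1) sC (M i) (e i)^-1).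

Lemma sigma_term_vars (t : 'S_k) e : generic gam k e ->
  sigma_term t e =
  prefactor qC (fun i : 'I_k => e i) *
  \prod_(x < k) \prod_(y < k | (x < y)%N) rfac qC (e (t x)) (e (t y)) *
  \prod_(i < k) phi_pair qC xiC sC (L (t^-1%g i)) (M i) (e i).
Proof.
move=> ge; rewrite /sigma_term mulrA -mulrA; congr (_ * _).
have -> : \prod_(i < k) phi qC xiC sC (L i) (e (t i)) =
          \prod_(i < k) phi qC xiC sC (L (t^-1%g i)) (e i).
  by rewrite [RHS](reindex_inj (@perm_inj _ t)); apply: eq_bigr => i _; rewrite permK.
rewrite -big_split; apply: eq_bigr => i _ /=.
by have [e0 nin nout] := generic_poles ge (ltn_ord i); apply: phi_dual_phi.
Qed.

(** The iterated integrals are indexed by [nat]; the values at indices from [k] on are arbitrary. *)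
Definition perm_nat (t : 'S_k) (i : nat) : nat := if insub i is Some j then val (t j) else i.

Lemma perm_natE (t : 'S_k) (i : 'I_k) : perm_nat t i = t i.
Proof. by rewrite /perm_nat valK. Qed.

Lemma has_iter_sigma_vanish (t : 'S_k) u0 (i : 'I_k) : L (t^-1%g i) != M i ->
  has_iter gam k 0 u0 (sigma_term t) 0.
Proof.
move=> /(mismatch_extremal L_ni M_ni) bad.
pose T := perm_nat (t^-1)%g; pose E x y := (T y < T x)%N.
pose f i := phi_pair qC xiC sC (L (T i)) (M i).
apply: (@has_iter_eq R gam k 0 u0
  (fun u => vars_prod k f u * pair_prod qC k E qC (-1) u)).
- exact: generic0.
- move=> e; rewrite add0n => ge; rewrite sigma_term_vars //.
  rewrite (prefactor_perm t (generic_pairs ge)) [LHS]mulrC; congr (_ * _).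
    by apply: eq_bigr => x _; apply: eq_bigl => y; rewrite /E /T !perm_natE.
  by apply: eq_bigr => j _; rewrite /f /T perm_natE.
have ordE (b : nat) (bk : (b < k)%N) : T b = (t^-1)%g (Ordinal bk) by rewrite /T -perm_natE.
case: bad => -[j hj hE].
  apply: (has_iter_vanish cg qC0 hI hO nestI nestO qC (-1) u0 (leqnn k) (ltn_ord j)).
    by move=> i' ik; exact: ratfun_phi.
  left; split; first by apply: ratfun_in => //; rewrite /T perm_natE.
  move=> b bj; have bk := ltn_trans bj (ltn_ord j).
  by rewrite /E (ordE b bk) /T perm_natE; apply: hE.
apply: (has_iter_vanish cg qC0 hI hO nestI nestO qC (-1) u0 (leqnn k) (ltn_ord j)).
  by move=> i' ik; exact: ratfun_phi.
right; split; first by apply: ratfun_out => //; rewrite /T perm_natE.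
move=> b /andP[jb bk].
by rewrite /E (ordE b bk) /T perm_natE; apply: hE.
Qed.

Let stab (t : 'S_k) := [forall i, L (t i) == L i].

(** At a generic point the sum over the stabilizer is the constant [symm_const] times one integrand
    common to all its elements, so only that integrand remains to be integrated. The exponent
    [k + k] collects [(1 - q) ^+ 2] from each variable. *)
Lemma has_iter_sigma_diag u0 : (forall i : 'I_k, L i = M i) ->
  has_iter gam k 0 u0 (fun e => \sum_(t | stab t) sigma_term t e)
    ((1 - qC) ^+ (k + k) * symm_const qC L k * diag_value qC L a (wfun xiC sC) k (fun=> 0%N)).
Proof.
move=> LM.
have hd : has_iter gam k 0 u0
    (fun u => vars_prod k (diag_factor qC L a (wfun xiC sC) (fun=> 0%N)) u *
    pair_prod qC k (fun x y => L x == L y) 1 (-1) u)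
    (diag_value qC L a (wfun xiC sC) k (fun=> 0%N)).
  apply: (has_iter_diag cg qC0 hI hO nestI nestO) => //.
  by move=> i ik; rewrite expr0 mul1r; exact: inner_in.
have := has_iterZ cg ((1 - qC) ^+ (k + k) * symm_const qC L k) (leqnn (0 + k)) hd.
apply: has_iter_eq; first exact: generic0.
move=> e; rewrite add0n => ge.
pose W := \prod_(i < k) phi_pair qC xiC sC (L i) (L i) (e i).
have WE : W = (1 - qC) ^+ (k + k) * vars_prod k (diag_factor qC L a (wfun xiC sC) (fun=> 0%N)) e.
  have -> : (1 - qC) ^+ (k + k) = \prod_(i < k) (1 - qC) ^+ 2.
    by rewrite prodr_const card_ord -exprM mul2n addnn.
  rewrite /vars_prod -big_split; apply: eq_bigr => i _ /=.
  by rewrite /phi_pair ltnn /diag_factor expr0 mul1r.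
pose S := \prod_(x < k) \prod_(y < k | (x < y)%N && (L x == L y))
     ((1 * e x + -1 * e y) / (e x - qC * e y)).
transitivity (W * S * \sum_(t | stab t) \prod_(x < k) \prod_(y < k | (x < y)%N && (L x == L y))
     rfac qC (e (t x)) (e (t y))).
  rewrite (@symmetrization _ qC qC0 L L_ni q1 k (fun i => e i)).
  - by rewrite WE /S /pair_prod /kernel; ring.
  - move=> x y exy; case: ge => _ de _; apply: val_inj.
    case: (ltngtP x y) => // h.
      by have := de x y; rewrite h ltn_ord exy eqxx => /(_ isT).
    by have := de y x; rewrite h ltn_ord exy eqxx => /(_ isT).
  - by move=> i; have [] := generic_poles ge (ltn_ord i).
rewrite mulr_sumr; apply: eq_bigr => t /forallP st.
have st' i : L (t i) = L i by exact/eqP/st.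
rewrite sigma_term_vars // (prefactor_stab L_ni st' (generic_pairs ge)) -/S.
rewrite -[LHS]mulrA [LHS]mulrC; congr (_ * _); apply: eq_bigr => i _.
by rewrite -LM -{1}(permKV t i) st'.
Qed.

Lemma has_iter_sigma_sum0 u0 (P : pred 'S_k) :
  (forall t : 'S_k, P t -> exists i, L (t^-1%g i) != M i) ->
  has_iter gam k 0 u0 (fun e => \sum_(t | P t) sigma_term t e) 0.
Proof.
move=> hP; under eq_fun do rewrite -big_filter.
have H := @has_iter_sum R gam k cg k 0 u0 _ [seq t <- index_enum _ | P t] sigma_term
  (fun=> 0) (leqnn (0 + k)).
rewrite big1 // in H; apply: H => t; rewrite mem_filter => /andP[/hP[i hi] _].
exact: has_iter_sigma_vanish hi.
Qed.

Lemma has_iter_sigma_sum u0 : (forall i : 'I_k, L i = M i) ->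
  has_iter gam k 0 u0 (fun e => \sum_t sigma_term t e)
    ((1 - qC) ^+ (k + k) * symm_const qC L k * diag_value qC L a (wfun xiC sC) k (fun=> 0%N)).
Proof.
move=> LM; rewrite -[X in has_iter _ _ _ _ _ X]addr0.
under eq_fun do rewrite (bigID stab).
apply: (has_iterD cg) => //; first exact: has_iter_sigma_diag.
apply: has_iter_sigma_sum0 => t; rewrite negb_forall => /existsP[i hi].
by exists (t i); rewrite permK -LM eq_sym.
Qed.

End Orthogonality.

Theorem theorem7p4 (R : realType) (q : R) (xi s : nat -> R)
  (q01 : 0 < q < 1)
  (xi_bnd : exists c d : R, 0 < c /\ forall j, c <= xi j <= d)
  (s_bnd : exists e : R, 0 < e /\ forall j, -1 + e <= s j <= - e)
  (hq : inf (range (fun j => `|s j| / xi j)) >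
        q * sup (range (fun j => `|s j| / xi j)))
  (hs : inf (range (fun j => (xi j * `|s j|)^-1)) >
        sup (range (fun j => `|s j| / xi j)))
  (k : nat) (k_ge1 : (1 <= k)%N)
  (lam mu : k.-tuple nat) (lam_sign : is_sign lam) (mu_sign : is_sign mu)
  (gam : 'I_k -> R -> R[i]) (hgam : admissible_contours q xi s gam) :
  let qC := q%:C in
  let xiC := fun j => (xi j)%:C in
  let sC := fun j => (s j)%:C in
  (1 - qC) ^- k *
  iter_oint gam (fun u =>
    (\prod_(a < k) \prod_(b < k | (a < b)%N)
       ((u a - u b) / (u a - qC * u b))) *
    Fc qC xiC sC lam u *
    \prod_(i < k)
       ((u i)^-1 * phi qC (fun j => (xiC j)^-1) sC (tnth mu i) (u i)^-1))
  = (lam == mu)%:R.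
Proof.
move=> qC xiC sC.
have xi_gt0 j : 0 < xi j.
  by case: xi_bnd => c [d [c0 h]]; have /andP[cx _] := h j; exact: lt_le_trans cx.
have s_lt0 j : -1 < s j < 0.
  by case: s_bnd => e [e0 h]; have /andP[h1 h2] := h j; apply/andP; split; lra.
case: hgam => gP g_in g_out g_nest _.
(* Extends the family to [nat], with the first contour as default value from [k] on. *)
pose gN i := gam (insubd (Ordinal k_ge1) i).
have gNE (i : 'I_k) : gN i = gam i by rewrite /gN valKd.
have gNlt i (ik : (i < k)%N) : gN i = gam (Ordinal ik) by rewrite -gNE.
have gNP i : (i < k)%N -> contour (gN i) by move=> ik; rewrite (gNlt i ik).
have gN_in i j : (i < k)%N -> curve_interior (gN i) ((xi j)^-1 * s j)%:C.
  by move=> ik; rewrite (gNlt i ik).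
have gN_out i j : (i < k)%N -> curve_exterior (gN i) ((xi j)^-1 * (s j)^-1)%:C.
  by move=> ik; rewrite (gNlt i ik).
have gN_nest i j : (i < j < k)%N -> forall z, trace (gN j) z -> curve_interior (gN i) (q%:C * z).
  move=> /andP[ij jk] z; rewrite (gNlt j jk) (gNlt i (ltn_trans ij jk)) => tz.
  by apply: (g_nest (Ordinal (ltn_trans ij jk)) (Ordinal jk)) => //; exists z.
have cg i : (i < k)%N -> closed_curve (gN i).
  by move=> /gNP[/simple_closed_curve_closed].
pose L := nth 0%N lam; pose M := nth 0%N mu.
have L_ni := sorted_geq_noninc lam_sign; have M_ni := sorted_geq_noninc mu_sign.
pose T := sigma_term q xi s (k := k) L M.
have integral V : has_iter gN k 0 (fun=> 0) (fun e => \sum_t T t e) V ->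
    iter_oint gam (fun u =>
    (\prod_(a < k) \prod_(b < k | (a < b)%N) ((u a - u b) / (u a - qC * u b))) *
    Fc qC xiC sC lam u *
    \prod_(i < k) ((u i)^-1 * phi qC (fun j => (xiC j)^-1) sC (tnth mu i) (u i)^-1)) =
    cS qC sC lam * V.
  move=> /(has_iterZ cg (cS qC sC lam) (leqnn (0 + k))).
  apply: (has_iter_iter_oint cg) => //; first by move=> i; rewrite add0n gNE.
  move=> e _; rewrite /Fc /Ffun mulrCA -mulrA; congr (_ * _).
  rewrite mulr_sumr mulr_suml; apply: eq_bigr => t _.
  rewrite /T /sigma_term /prefactor /rfac; congr (_ * (_ * _) * _).
    by apply: eq_bigr => i _; rewrite (tnth_nth 0%N).
  by apply: eq_bigr => i _; rewrite (tnth_nth 0%N).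
have q1 : qC != 1 by rewrite eq_sym -subr_eq0 realC_neq1 //; case/andP: q01.
have [lm|lm] := eqVneq lam mu; last first.
  rewrite (integral 0) ?mulr0 //.
  (* Every permutation has a mismatch: otherwise [mu] would be a rearrangement of [lam], and sorted
     rearrangements coincide. *)
  apply: (has_iter_sigma_sum0 q01 xi_gt0 s_lt0 gNP gN_in gN_out gN_nest L_ni M_ni) => t _.
  apply: contrapT => nex; case/eqP: lm; apply/val_inj => /=.
  have geq_trans : transitive geq by move=> x y z h1 h2; exact: leq_trans h2 h1.
  have geq_anti : antisymmetric geq by move=> x y h; apply/esym/anti_leq.
  apply: (sorted_eq geq_trans geq_anti lam_sign mu_sign).
  rewrite perm_sym; apply/tuple_permP; exists (t^-1)%g; congr val; apply: eq_from_tnth => i.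
  rewrite tnth_mktuple !(tnth_nth 0%N); apply/eqP; rewrite eq_sym.
  by apply: contraT => h; case: nex; exists i.
have h := has_iter_sigma_sum q01 xi_gt0 s_lt0 gNP gN_in gN_out gN_nest L_ni M_ni
  (fun=> 0) (fun i => congr1 (fun l : k.-tuple nat => nth 0%N l i) lm).
rewrite (integral _ h) -/qC.
pose B := (\max_(i < k) L i).+1.
have hB i : (L i < B)%N.
  have [ik|ik] := ltnP i k; last by rewrite /L nth_default ?size_tuple.
  by rewrite ltnS; exact: (leq_bigmax (F := fun i : 'I_k => L i) (Ordinal ik)).
pose P1 := \prod_(j < B) qpoch qC (sC j ^+ 2) (mult L k j).
pose P2 := \prod_(j < B) qpoch qC qC (mult L k j).
have P20 : P2 != 0 by apply/prodf_neq0 => j _; exact: qpoch_q_neq0.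
have cE : cS qC sC lam = P1 / P2 by rewrite (cS_mult qC sC hB) prodf_div.
have symE : (1 - qC) ^+ k * symm_const qC L k = P2.
  by apply: (symm_const_qpoch q1) => i _; exact: hB.
have xi0 j : xiC j != 0 by rewrite fmorph_eq0 gt_eqF.
have diagE : diag_value qC L (inner_pole xiC sC) (wfun xiC sC) k (fun=> 0%N) * P1 = 1.
  rewrite (diag_value_qpoch xi0 (fun j n => one_sub_sqr_exp_neq0 n q01 (s_lt0 j))) //.
  by rewrite big1 // => j _; rewrite /qpoch big_ord0.
have qk : (1 - qC) ^+ k != 0 by rewrite expf_neq0 // subr_eq0 eq_sym.
rewrite cE exprD; set V := diag_value _ _ _ _ _ _.
(* Of the [2k] factors [1 - q], half cancel the normalization and half turn the symmetrization
   constant into [P2], the denominator of [cS]; the residues [V] are inverse to its numerator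
   [P1]. *)
transitivity (((1 - qC) ^+ k)^-1 * (1 - qC) ^+ k * (P2^-1 * ((1 - qC) ^+ k * symm_const qC L k)) *
  (V * P1)); first by ring.
by rewrite symE diagE !mulVf // !mulr1.
Qed.
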